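(* Let $(X,\mu)$, $(X_1,\mu_1)$, $(Y,\nu)$ and $(Y_1,\nu_1)$ be standard measure spaces and let $\varphi:X\to X_1$ and $\psi:Y\to Y_1$ be measurable mappings such that the measure $\varphi_*\mu$ on $X_1$, given by $\varphi_*\mu(\alpha_1)=\mu(\varphi^{-1}(\alpha_1))$, is absolutely continuous with respect to $\mu_1$ and, similarly, $\psi_*\nu$ is absolutely continuous with respect to $\nu_1$. Let $\kappa_1\subseteq X_1\times Y_1$ be an $\omega$-closed set and $$\kappa=\{(x,y)\in X\times Y : (\varphi(x),\psi(y))\in\kappa_1\}.$$ Assume that $X=\bigcup_{i=0}^N\tilde X_i$ and $Y=\bigcup_{j=0}^M\tilde Y_j$ are (finite) partitions of $X$ and $Y$ into measurable sets such that (i) $\varphi|_{\tilde X_0}$ and $\psi|_{\tilde Y_0}$ are one-to-one, and (ii) $\varphi|_{\tilde X_i}$ and $\psi|_{\tilde Y_j}$ are constant almost everywhere for $i\geq 1$ and $j\geq 1$. If $\kappa_1$ is a set of compact operator synthesis then so is $\kappa$.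
   Context: A standard measure space $(X,\mu)$ is a set $X$ equipped with the Borel $\sigma$-algebra of a locally compact Hausdorff metrisable complete (separable) topology, with $\mu$ a regular Borel $\sigma$-finite measure. For standard measure spaces $(X,\mu)$, $(Y,\nu)$ put $H_1=L^2(X,\mu)$, $H_2=L^2(Y,\nu)$, $\mathcal{K}=$ the compact operators in $\mathcal{B}(H_1,H_2)$, and let $P(\alpha)$ denote multiplication by the characteristic function $\chi_\alpha$ of a measurable set $\alpha$. A rectangle is a set $\alpha\times\beta$ with $\alpha\subseteq X$, $\beta\subseteq Y$ measurable. A set $F\subseteq X\times Y$ is marginally null if $F\subseteq (M\times Y)\cup(X\times N)$ with $\mu(M)=\nu(N)=0$; two sets are marginally equivalent if their symmetric difference is marginally null. A set is $\omega$-open if it is marginally equivalent to a countable union of rectangles, and $\omega$-closed if its complement is $\omega$-open. Let $\mathcal{T}(X,Y)$ be the projective tensor product $H_1\hat\otimes H_2$, viewed as the space of functions (up to marginally null sets) $h(x,y)=\sum_i f_i(x)g_i(y)$ with $(f_i)\subseteq H_1$, $(g_i)\subseteq H_2$ square summable sequences; its dual is $\mathcal{B}(H_1,H_2)$ via $\langle T,f\otimes g\rangle=(Tf,\bar g)$. For an $\omega$-closed set $\kappa$, let $\mathfrak{M}_{\max}(\kappa)$ be the set of all $T\in\mathcal{B}(H_1,H_2)$ supported by $\kappa$, i.e. with $P(\beta)TP(\alpha)=0$ whenever the rectangle $\alpha\times\beta$ has marginally null intersection with $\kappa$; and let $\mathfrak{M}_{\min}(\kappa)=\Phi(\kappa)^\perp$,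 where $\Phi(\kappa)=\{h\in\mathcal{T}(X,Y): h\chi_\kappa=0 \text{ marginally almost everywhere}\}$. (Equivalently, $\mathfrak{M}_{\min}(\kappa)$ is the smallest weak* closed masa-bimodule with support $\kappa$.) The $\omega$-closed set $\kappa$ is a set of compact operator synthesis if $\mathfrak{M}_{\min}(\kappa)\cap\mathcal{K}=\mathfrak{M}_{\max}(\kappa)\cap\mathcal{K}$. *)

(* Defs.v *)
From HB Require Import structures.
From mathcomp Require Import all_boot all_order all_algebra.
From mathcomp Require Import all_classical all_reals all_analysis.
From mathcomp Require Import complex.

Set Implicit Arguments.
Unset Strict Implicit.
Unset Printing Implicit Defensive.

Import Order.TTheory GRing.Theory Num.Theory.
Import numFieldNormedType.Exports.

Local Open Scope classical_set_scope.
Local Open Scope complex_scope.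
Local Open Scope ring_scope.

(* The metric is a witness of complete metrisability: the definitions below use
   only the topology it induces. *)
#[short(type="pointedCompleteMetricType")]
HB.structure Definition PointedCompleteMetric (K : numDomainType) :=
  {M of Metric K M & Complete M & Pointed M}.

Definition borel (T : ptopologicalType) := g_sigma_algebraType (@open T).

Section StandardMeasure.
Context {R : realType} {T : pointedCompleteMetricType R}.
Variable mu : {measure set (borel T) -> \bar R}.

Definition regular_measure := forall A : set (borel T), measurable A ->
  mu A = ereal_inf [set mu U | U in [set U : set T | open U /\ A `<=` U]] /\
  mu A = ereal_sup [set mu K | K in [set K : set T | compact K /\ K `<=` A]].

Definition standard_measure :=
  [/\ locally_compact [set: T],
      exists2 D : set T, countable D & dense D,
      regular_measure &
      sigma_finite [set: borel T] mu].

End StandardMeasure.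

Section SquareIntegrable.
Context {d : measure_display} {X : measurableType d} {R : realType}.
Variable mu : {measure set X -> \bar R}.

Definition L2norm (f : X -> R[i]) : \bar R :=
  Lnorm mu 2%:E (fun x => (ComplexField.Normc.normc (f x))%:E).

(* The Hilbert space L^2(X, mu) is the quotient of this set of functions by
   almost everywhere equality. The quotient is not formed: operators are maps
   on representatives, and equations between vectors hold almost everywhere. *)
Definition L2 : set (X -> R[i]) :=
  [set f | [/\ measurable_fun [set: X] (fun x => complex.Re (f x)),
               measurable_fun [set: X] (fun x => complex.Im (f x)) &
               (L2norm f < +oo)%E]].

Definition cintegral (h : X -> R[i]) : R[i] :=
  (\int[mu]_x complex.Re (h x)) +i* (\int[mu]_x complex.Im (h x)).

(* Linear in the first argument. *)
Definition L2inner (f g : X -> R[i]) : R[i] :=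
  cintegral (fun x => f x * (g x)^*).

(* The multiplication operator P(alpha). *)
Definition mulchi (alpha : set X) (f : X -> R[i]) : X -> R[i] :=
  fun x => (\1_alpha x)%:C * f x.

Definition square_summable (f : nat -> X -> R[i]) :=
  (forall n, L2 (f n)) /\ (\sum_(0 <= n <oo) L2norm (f n) ^+ 2 < +oo)%E.

Definition ae_constant_on {Z : Type} (A : set X) (phi : X -> Z) :=
  exists c, {ae mu, forall x, A x -> phi x = c}.

End SquareIntegrable.

Section Synthesis.
Context {dX : measure_display} {X : measurableType dX}.
Context {dY : measure_display} {Y : measurableType dY} {R : realType}.
Variables (mu : {measure set X -> \bar R}) (nu : {measure set Y -> \bar R}).

Definition marginally_null (F : set (X * Y)) :=
  exists M N, [/\ measurable M /\ mu M = 0%E, measurable N /\ nu N = 0%E &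
                  F `<=` (M `*` [set: Y]) `|` ([set: X] `*` N)].

Definition marginally_equivalent (E F : set (X * Y)) :=
  marginally_null (E `+` F).

Definition marginally_ae (P : X * Y -> Prop) := marginally_null (~` [set p | P p]).

Definition omega_open (E : set (X * Y)) :=
  exists (alpha : nat -> set X) (beta : nat -> set Y),
    [/\ forall n, measurable (alpha n), forall n, measurable (beta n) &
        marginally_equivalent E (\bigcup_n (alpha n `*` beta n))].

Definition omega_closed (kappa : set (X * Y)) := omega_open (~` kappa).

Definition bounded_operator : set ((X -> R[i]) -> (Y -> R[i])) :=
  [set T | [/\ forall f, L2 mu f -> L2 nu (T f),
               forall f g, L2 mu f -> L2 mu g -> f = g %[ae mu] ->
                 T f = T g %[ae nu],
               forall (a : R[i]) f g, L2 mu f -> L2 mu g ->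
                 T (fun x => a * f x + g x) =
                   (fun y => a * T f y + T g y) %[ae nu] &
               exists C : R, forall f, L2 mu f ->
                 (L2norm nu (T f) <= C%:E * L2norm mu f)%E]].

Definition compact_operator : set ((X -> R[i]) -> (Y -> R[i])) :=
  [set T | bounded_operator T /\
    forall f : nat -> X -> R[i], (forall n, L2 mu (f n)) ->
      (exists C : R, forall n, (L2norm mu (f n) <= C%:E)%E) ->
      exists (k : nat -> nat) (g : Y -> R[i]),
        [/\ {homo k : m n / (m < n)%N}, L2 nu g &
            L2norm nu (fun y => T (f (k n)) y - g y) @[n --> \oo] --> 0%E]].

(* h represents the element \sum_n f_n (x) g_n of the projective tensor product
   of L^2(X, mu) and L^2(Y, nu). *)
Definition tensor_expansion (h : X * Y -> R[i]) (f : nat -> X -> R[i])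
    (g : nat -> Y -> R[i]) :=
  [/\ square_summable mu f, square_summable nu g &
      marginally_ae (fun p =>
        (\sum_(0 <= k < n) f k p.1 * g k p.2 : R[i]^o) @[n --> \oo]
          --> (h p : R[i]^o))].

Definition projective_tensor : set (X * Y -> R[i]) :=
  [set h | exists f g, tensor_expansion h f g].

(* The duality <T, h> = \sum_n (T f_n, conj g_n); it is a relation so that its
   independence of the expansion of h is not presupposed. *)
Definition pairing (T : (X -> R[i]) -> (Y -> R[i])) (h : X * Y -> R[i])
    (z : R[i]) :=
  exists f g, tensor_expansion h f g /\
    (\sum_(0 <= k < n) L2inner nu (T (f k)) (fun y => (g k y)^*) : R[i]^o)
      @[n --> \oo] --> (z : R[i]^o).

Definition Phi (kappa : set (X * Y)) : set (X * Y -> R[i]) :=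
  [set h | projective_tensor h /\
           marginally_ae (fun p => h p * (\1_kappa p)%:C = 0)].

Definition Mmax (kappa : set (X * Y)) : set ((X -> R[i]) -> (Y -> R[i])) :=
  [set T | bounded_operator T /\
    forall (alpha : set X) (beta : set Y), measurable alpha -> measurable beta ->
      marginally_null ((alpha `*` beta) `&` kappa) ->
      forall f, L2 mu f ->
        mulchi beta (T (mulchi alpha f)) = (fun=> 0) %[ae nu]].

Definition Mmin (kappa : set (X * Y)) : set ((X -> R[i]) -> (Y -> R[i])) :=
  [set T | bounded_operator T /\
    forall h, Phi kappa h -> forall z, pairing T h z -> z = 0].

Definition compact_operator_synthesis (kappa : set (X * Y)) :=
  omega_closed kappa /\
  Mmin kappa `&` compact_operator = Mmax kappa `&` compact_operator.

End Synthesis.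

(* Main.v *)
From HB Require Import structures.
Require Import Defs.
From mathcomp Require Import all_boot all_order all_algebra.
From mathcomp Require Import all_classical all_reals all_analysis measurable_realfun.
From mathcomp Require Import complex ring lra.
Import Order.TTheory GRing.Theory Num.Theory.
Import numFieldNormedType.Exports.
Local Open Scope classical_set_scope.
Local Open Scope ring_scope.
Set Implicit Arguments.
Unset Strict Implicit.
Unset Printing Implicit Defensive.

(* Let T be a compact operator supported by kappa, and h = sum_k f_k (x) g_k an
   element of Phi(kappa); one has to show sum_k (T f_k, conj g_k) = 0. The sum
   splits over the rectangles X_i x Y_j.

   If phi is a.e. constant on X_i (or psi on Y_j), the rectangle splits further
   into a rectangle disjoint from kappa, where T vanishes, and a rectangle inside
   kappa, where h vanishes. In the latter case the sum is zero because the pairing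
   depends on h only: (f_k)_k and (g_k)_k are approximated in L^2(l^2) by step
   functions with values (f_k(x))_k and (g_k(y))_k, for which the pairing is a
   combination of the numbers h(x, y).

   On X_0 x Y_0, inner regularity and Lusin's theorem exhaust X_0 and Y_0 by sets
   A and B on which phi and psi have measurable inverses and image measures with
   densities bounded above and below. Then T restricted to A x B becomes a compact
   operator from L^2(X_1) to L^2(Y_1) supported by kappa_1, to which the synthesis
   of kappa_1 applies. *)

(** The pairing with T goes through an expansion of h that converges only pointwise off a marginally
    null set, so the vanishing of h on a rectangle says nothing directly about the sum of the (T
    f_k, conj g_k). Claims about blocks are therefore phrased as partial sums tending to zero, a
    form stable under finite sums and under errors uniform in the number of terms. The uniformity
    comes from the bound ab <= (t a^2 + b^2 / t) / 2, which can be summed over k before t is chosen.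

    On X_0 x Y_0 two obstacles shape the transfer. Measurability of the image and of the inverse of
    phi is obtained on compact sets where phi is continuous. The density of the image measure may be
    unbounded or come close to zero, while moving L^2 functions in both directions needs it between
    1/c and c. The density is attached to the second factor of each tensor alone, which keeps the
    value of the pairing. Compactness survives because the new operator is T composed with bounded
    maps on both sides. *)

Local Notation normc := ComplexField.Normc.normc.
Local Notation Re := complex.Re.
Local Notation Im := complex.Im.

(** * Complex numbers and null sequences *)

Section complex_modulus.
Variable R : realType.
Implicit Types z w : R[i].

Lemma normc_ge0 z : 0 <= normc z.
Proof. by case: z => a b /=; exact: sqrtr_ge0. Qed.

Lemma normc_sqr z : normc z ^+ 2 = Re z ^+ 2 + Im z ^+ 2.
Proof. by case: z => a b /=; rewrite sqr_sqrtr // addr_ge0 ?sqr_ge0. Qed.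

Lemma normr_Re_le z : `|Re z| <= normc z.
Proof.
rewrite -(@ler_pXn2r _ 2) ?nnegrE ?normc_ge0 //.
by rewrite normc_sqr real_normK ?num_real // lerDl sqr_ge0.
Qed.

Lemma normr_Im_le z : `|Im z| <= normc z.
Proof.
rewrite -(@ler_pXn2r _ 2) ?nnegrE ?normc_ge0 //.
by rewrite normc_sqr real_normK ?num_real // lerDr sqr_ge0.
Qed.

Lemma normc_le_ReIm z : normc z <= `|Re z| + `|Im z|.
Proof.
rewrite -(@ler_pXn2r _ 2) ?nnegrE ?normc_ge0 ?addr_ge0 //.
rewrite normc_sqr -(real_normK (num_real (Re z))) -(real_normK (num_real (Im z))).
have := normr_ge0 (Re z); have := normr_ge0 (Im z); nra.
Qed.

Lemma normc_real (x : R) : normc x%:C%C = `|x|.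
Proof. by rewrite /= expr0n /= addr0 sqrtr_sqr. Qed.

Lemma conj_conjc z : z^* = z^*%C.
Proof. by []. Qed.

Lemma normc_conj z : normc z^* = normc z.
Proof. by rewrite conj_conjc; case: z => a b /=; rewrite sqrrN. Qed.

Lemma normc_sqrD z w : normc (z + w) ^+ 2 <= 2 * normc z ^+ 2 + 2 * normc w ^+ 2.
Proof.
rewrite !normc_sqr; case: z => a b; case: w => c d /=.
have := sqr_ge0 (a - c); have := sqr_ge0 (b - d); nra.
Qed.

Lemma normc_sum (I : Type) (r : seq I) (F : I -> R[i]) :
  normc (\sum_(i <- r) F i) <= \sum_(i <- r) normc (F i).
Proof.
elim: r => [|i r IH]; first by rewrite !big_nil ComplexField.Normc.normc0.
by rewrite !big_cons (le_trans (le_normcD _ _)) // lerD2l.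
Qed.

Lemma Re_mulc z w : Re (z * w) = Re z * Re w - Im z * Im w.
Proof. by case: z; case: w. Qed.

Lemma Im_mulc z w : Im (z * w) = Re z * Im w + Im z * Re w.
Proof. by case: z => a b; case: w => c d /=. Qed.

Lemma Re_addc z w : Re (z + w) = Re z + Re w.
Proof. by case: z; case: w. Qed.

Lemma Im_addc z w : Im (z + w) = Im z + Im w.
Proof. by case: z; case: w. Qed.

Lemma complexP z w : Re z = Re w -> Im z = Im w -> z = w.
Proof. by case: z => a b; case: w => c d /= -> ->. Qed.

(** Convergence in R[i] is reduced to the real modulus; [cvg_null_seq] is the bridge to the limits
    in the definitions of the pairing and of tensor expansions. *)
Definition null_seq (u : nat -> R[i]) := normc (u n) @[n --> \oo] --> (0 : R).

Lemma null_seqP u : null_seq u <->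
  forall e : R, 0 < e -> exists N, forall n, (N <= n)%N -> normc (u n) < e.
Proof.
split.
  move/cvgrPdist_lt => h e e0; have [N _ hN] := h _ e0.
  exists N => n Nn; have := hN n Nn.
  by rewrite /= sub0r normrN ger0_norm ?normc_ge0.
move=> h; apply/cvgrPdist_lt => e e0; have [N hN] := h _ e0.
exists N => // n Nn /=.
by rewrite sub0r normrN ger0_norm ?normc_ge0 //; exact: hN.
Qed.

Lemma cvg_null_seq (u : nat -> R[i]) (l : R[i]) :
  ((u : nat -> R[i]^o) @ \oo --> (l : R[i]^o)) <-> null_seq (fun n => u n - l).
Proof.
rewrite null_seqP; split.
  move/cvgrPdist_lt => h e e0.
  have e0' : 0 < e%:C%C by rewrite ltcR.
  have [N _ hN] := h _ e0'.
  exists N => n Nn; have := hN n Nn.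
  rewrite /= distrC; case: (u n - l) => a b /=; by rewrite ltcR.
move=> h; apply/cvgrPdist_lt => e e0.
(* The norm of R[i] takes values in R[i] itself; a positive element there is real, so real radii
   suffice. *)
have [r r0 re] : exists2 r : R, 0 < r & e = r%:C%C.
  by move: e0; case: e => a b; rewrite ltcE /= => /andP[/eqP -> a0]; exists a.
have [N hN] := h _ r0; exists N => // n Nn.
by rewrite re /= distrC; have := hN n Nn; case: (u n - l) => a b /=; rewrite ltcR.
Qed.

Lemma null_seqD u v : null_seq u -> null_seq v -> null_seq (fun n => u n + v n).
Proof.
move=> hu hv; apply/null_seqP => e e0.
have e2 : 0 < e / 2 by rewrite divr_gt0.
move/null_seqP : hu => /(_ _ e2)[N hN]; move/null_seqP : hv => /(_ _ e2)[M hM].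
exists (maxn N M) => n; rewrite geq_max => /andP[Nn Mn].
rewrite (le_lt_trans (le_normcD _ _)) // [e]splitr ltrD //; [exact: hN|exact: hM].
Qed.

Lemma null_seqZ (a : R[i]) u : null_seq u -> null_seq (fun n => a * u n).
Proof.
rewrite /null_seq => hu.
under eq_fun do rewrite ComplexField.Normc.normcM.
by rewrite -(mulr0 (normc a)); exact: cvgMr hu.
Qed.

Lemma null_seq0 : null_seq (fun=> 0).
Proof. by rewrite /null_seq ComplexField.Normc.normc0; exact: cvg_cst. Qed.

Lemma null_seq_sum (I : Type) (r : seq I) (u : I -> nat -> R[i]) :
  (forall i, null_seq (u i)) -> null_seq (fun n => \sum_(i <- r) u i n).
Proof.
move=> hu; elim: r => [|i r IH].
  by under eq_fun do rewrite big_nil; exact: null_seq0.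
by under eq_fun do rewrite big_cons; exact: null_seqD.
Qed.

Lemma null_seq_unique (u : nat -> R[i]) z :
  null_seq u -> null_seq (fun n => u n - z) -> z = 0.
Proof.
move=> h1 h2; apply/ComplexField.Normc.eq0_normc.
have h : null_seq (fun=> z).
  have := null_seqD h1 (null_seqZ (-1) h2).
  by congr (null_seq _); apply/funext => n; ring.
exact: (cvg_unique _ (cvg_cst _) h).
Qed.

End complex_modulus.

(** * Square integrable functions *)

Section complex_measurable.
Context d (X : measurableType d) (R : realType).
Implicit Types f g : X -> R[i].

Definition cmeasurable f :=
  measurable_fun [set: X] (fun x => Re (f x)) /\
  measurable_fun [set: X] (fun x => Im (f x)).

Lemma cmeasurable_cst (a : R[i]) : cmeasurable (fun=> a).
Proof. by split; exact: measurable_cst. Qed.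

Lemma cmeasurableD f g : cmeasurable f -> cmeasurable g ->
  cmeasurable (fun x => f x + g x).
Proof.
move=> [f1 f2] [g1 g2]; split.
  by under eq_fun do rewrite Re_addc; exact: measurable_funD.
by under eq_fun do rewrite Im_addc; exact: measurable_funD.
Qed.

Lemma cmeasurableM f g : cmeasurable f -> cmeasurable g ->
  cmeasurable (fun x => f x * g x).
Proof.
move=> [f1 f2] [g1 g2]; split.
  under eq_fun do rewrite Re_mulc.
  by apply: measurable_funB; exact: measurable_funM.
under eq_fun do rewrite Im_mulc.
by apply: measurable_funD; exact: measurable_funM.
Qed.

Lemma cmeasurable_real (r : X -> R) : measurable_fun [set: X] r ->
  cmeasurable (fun x => (r x)%:C%C).
Proof. by move=> mr; split => //=; exact: measurable_cst. Qed.

Lemma cmeasurable_mulchi (A : set X) f : measurable A -> cmeasurable f ->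
  cmeasurable (mulchi A f).
Proof.
by move=> mA mf; apply: cmeasurableM => //; apply: cmeasurable_real;
  exact: measurable_indic.
Qed.

Lemma cmeasurable_conj f : cmeasurable f -> cmeasurable (fun x => (f x)^*).
Proof.
move=> [f1 f2]; split; under eq_fun do rewrite conj_conjc.
  rewrite (_ : (fun _ => _) = (fun x => Re (f x))) //.
  by apply/funext => x; case: (f x).
rewrite (_ : (fun _ => _) = (fun x => - Im (f x))); last first.
  by apply/funext => x; case: (f x).
exact: measurable_funN.
Qed.

Lemma measurable_normc_sqr f : cmeasurable f ->
  measurable_fun [set: X] (fun x => normc (f x) ^+ 2).
Proof.
move=> [f1 f2]; under eq_fun do rewrite normc_sqr.
by apply: measurable_funD; exact: measurable_funX.
Qed.

Lemma mulchiE (A : set X) f x : mulchi A f x = if x \in A then f x else 0.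
Proof.
by rewrite /mulchi indicE; case: (x \in A); rewrite ?mul1r ?mul0r.
Qed.

Lemma mulchiT f : mulchi [set: X] f = f.
Proof. by apply/funext => x; rewrite mulchiE in_setT. Qed.

Lemma mulchiU (A B : set X) f : [disjoint A & B] ->
  mulchi (A `|` B) f = fun x => mulchi A f x + mulchi B f x.
Proof.
move=> /disj_setPS AB; apply/funext => x; rewrite !mulchiE in_setU.
case: (boolP (x \in A)) => xA; case: (boolP (x \in B)) => xB /=;
  rewrite ?addr0 ?add0r //.
by case: (AB x); split; exact: set_mem.
Qed.

End complex_measurable.

Lemma cmeasurable_comp d d' (X : measurableType d) (Z : measurableType d')
    (R : realType) (h : Z -> X) (f : X -> R[i]) :
  measurable_fun [set: Z] h -> cmeasurable f -> cmeasurable (f \o h).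
Proof.
by move=> mh [f1 f2]; split;
  [exact: (measurableT_comp f1 mh)|exact: (measurableT_comp f2 mh)].
Qed.

Section L2_space.
Context d (X : measurableType d) (R : realType) (mu : {measure set X -> \bar R}).
Implicit Types f g : X -> R[i].
Local Open Scope ereal_scope.

(** The squared L^2 norm: it is additive over disjoint sets and avoids the root in [L2norm]. *)
Definition sqint f : \bar R := \int[mu]_x (normc (f x) ^+ 2)%:E.

Lemma sqint_ge0 f : 0 <= sqint f.
Proof. by apply: integral_ge0 => x _; rewrite lee_fin sqr_ge0. Qed.

Lemma L2normE f : L2norm mu f = sqrte (sqint f).
Proof.
rewrite /L2norm unlock -poweR12_sqrt ?sqint_ge0 //; congr (_ `^ _).
apply: eq_integral => x _; rewrite /= ger0_norm ?normc_ge0 //.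
by rewrite powR_mulrn ?normc_ge0.
Qed.

Lemma L2norm_sqr f : L2norm mu f ^+ 2 = sqint f.
Proof. by rewrite L2normE sqr_sqrte ?sqint_ge0. Qed.

Lemma L2P f : L2 mu f <-> cmeasurable f /\ sqint f < +oo.
Proof.
have h : (L2norm mu f < +oo) <-> (sqint f < +oo).
  rewrite L2normE; have := sqint_ge0 f; case: (sqint f) => [r|_|] //=.
  by rewrite !ltry.
split; first by move=> [? ? /h].
by move=> [[? ?] /h ?].
Qed.

Lemma measurable_sqint f : cmeasurable f ->
  measurable_fun [set: X] (fun x => (normc (f x) ^+ 2)%:E).
Proof. by move=> mf; apply/measurable_EFinP; exact: measurable_normc_sqr. Qed.

Lemma sqintZ (a : R[i]) f : cmeasurable f ->
  sqint (fun x => a * f x)%R = (normc a ^+ 2)%:E * sqint f.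
Proof.
move=> mf; rewrite /sqint -ge0_integralZl_EFin ?sqr_ge0 //; last first.
- exact: measurable_sqint.
- by move=> x _; rewrite lee_fin sqr_ge0.
by apply: eq_integral => x _; rewrite ComplexField.Normc.normcM exprMn EFinM.
Qed.

Lemma sqintD f g : cmeasurable f -> cmeasurable g ->
  sqint (fun x => f x + g x)%R <= 2%:E * sqint f + 2%:E * sqint g.
Proof.
move=> mf mg.
have mf2 := measurable_sqint mf; have mg2 := measurable_sqint mg.
have f0 x : [set: X] x -> 0 <= (normc (f x) ^+ 2)%:E by rewrite lee_fin sqr_ge0.
have g0 x : [set: X] x -> 0 <= (normc (g x) ^+ 2)%:E by rewrite lee_fin sqr_ge0.
rewrite /sqint -(ge0_integralZl_EFin mu measurableT f0) //.
rewrite -(ge0_integralZl_EFin mu measurableT g0) //.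
rewrite -ge0_integralD //; [|by move=> x _; rewrite mule_ge0 ?lee_fin ?sqr_ge0|
  exact: measurable_funeM|by move=> x _; rewrite mule_ge0 ?lee_fin ?sqr_ge0|
  exact: measurable_funeM].
apply: ge0_le_integral => //.
- by move=> x _; rewrite lee_fin sqr_ge0.
- by apply: measurable_sqint; exact: cmeasurableD.
- by apply: emeasurable_funD; exact: measurable_funeM.
- by move=> x _; rewrite -!EFinM -EFinD lee_fin normc_sqrD.
Qed.

Lemma sqint_mulchi (A : set X) f : measurable A ->
  sqint (mulchi A f) = \int[mu]_(x in A) (normc (f x) ^+ 2)%:E.
Proof.
move=> mA; rewrite /sqint [RHS]integral_mkcond; apply: eq_integral => x _.
rewrite mulchiE patchE; case: ifP => // _.
by rewrite ComplexField.Normc.normc0 expr0n.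
Qed.

Lemma sqint_mulchi_le (A : set X) f : measurable A -> cmeasurable f ->
  sqint (mulchi A f) <= sqint f.
Proof.
move=> mA mf; rewrite sqint_mulchi //; apply: ge0_subset_integral => //.
- exact: measurable_sqint.
- by move=> x _; rewrite lee_fin sqr_ge0.
Qed.

Lemma L2_cmeasurable f : L2 mu f -> cmeasurable f.
Proof. by case/L2P. Qed.

Lemma L2_lty f : L2 mu f -> sqint f < +oo.
Proof. by case/L2P. Qed.

Lemma L2_mulchi (A : set X) f : measurable A -> L2 mu f -> L2 mu (mulchi A f).
Proof.
move=> mA /L2P[mf f2]; apply/L2P; split; first exact: cmeasurable_mulchi.
exact: le_lt_trans (sqint_mulchi_le _ _) f2.
Qed.

Lemma L2D f g : L2 mu f -> L2 mu g -> L2 mu (fun x => f x + g x)%R.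
Proof.
move=> /L2P[mf f2] /L2P[mg g2]; apply/L2P; split; first exact: cmeasurableD.
by apply: (le_lt_trans (sqintD mf mg)); rewrite lte_add_pinfty // lte_mul_pinfty
  ?lee_fin.
Qed.

Lemma L2Z a f : L2 mu f -> L2 mu (fun x => a * f x)%R.
Proof.
move=> /L2P[mf f2]; apply/L2P; split.
  by apply: cmeasurableM => //; exact: cmeasurable_cst.
by rewrite sqintZ // lte_mul_pinfty ?lee_fin ?sqr_ge0.
Qed.

Lemma L2_conj f : L2 mu f -> L2 mu (fun x => (f x)^*).
Proof.
move=> /L2P[mf f2]; apply/L2P; split; first exact: cmeasurable_conj.
by rewrite /sqint; under eq_integral do rewrite normc_conj.
Qed.

Lemma L2_0 : L2 mu (fun=> 0%R).
Proof.
apply/L2P; split; first exact: cmeasurable_cst.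
rewrite /sqint; under eq_integral do rewrite ComplexField.Normc.normc0 expr0n.
by rewrite integral0.
Qed.

Lemma L2_sum (I : Type) (r : seq I) (F : I -> X -> R[i]) :
  (forall i, L2 mu (F i)) -> L2 mu (fun x => \sum_(i <- r) F i x)%R.
Proof.
move=> hF; elim: r => [|i r IH].
  by under eq_fun do rewrite big_nil; exact: L2_0.
by under eq_fun do rewrite big_cons; exact: L2D.
Qed.

Lemma L2_mulchi_cst (A : set X) a : measurable A -> mu A < +oo ->
  L2 mu (mulchi A (fun=> a)).
Proof.
move=> mA Aoo; apply/L2P; split.
  by apply: cmeasurable_mulchi => //; exact: cmeasurable_cst.
by rewrite sqint_mulchi // integral_cst // lte_mul_pinfty ?lee_fin ?sqr_ge0.
Qed.

Lemma sqint_eq0 f : cmeasurable f -> sqint f = 0 -> f = (fun=> 0%R) %[ae mu].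
Proof.
move=> mf f0.
have : ae_eq mu setT (fun x => (normc (f x) ^+ 2)%:E) (cst 0).
  apply/(ae_eq_integral_abs mu measurableT (measurable_sqint mf)).
  rewrite -[RHS]f0; apply: eq_integral => x _.
  by rewrite gee0_abs // lee_fin sqr_ge0.
apply: filterS => x /= + _ => /(_ Logic.I) [] /eqP.
by rewrite sqrf_eq0 => /eqP /ComplexField.Normc.eq0_normc.
Qed.

Lemma ae_eq_sqint f g : cmeasurable f -> cmeasurable g -> f = g %[ae mu] ->
  sqint f = sqint g.
Proof.
move=> mf mg fg; apply: ae_eq_integral => //; try exact: measurable_sqint.
by apply: filterS fg => x /= h /h ->.
Qed.

End L2_space.

Lemma L2norm_le d d' (X : measurableType d) (Y : measurableType d')
    (R : realType) (mu : {measure set X -> \bar R}) (nu : {measure set Y -> \bar R})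
    (f : X -> R[i]) (g : Y -> R[i]) (c : R) : 0 <= c ->
  (sqint mu f <= (c ^+ 2)%:E * sqint nu g)%E ->
  (L2norm mu f <= c%:E * L2norm nu g)%E.
Proof.
move=> c0 h; have n0 : (0 <= L2norm nu g)%E by exact: Lnorm_ge0.
have -> : (c%:E * L2norm nu g = sqrte ((c%:E * L2norm nu g) ^+ 2))%E.
  by rewrite sqrte_sqr gee0_abs // mule_ge0.
rewrite L2normE lee_sqrt; last by rewrite expe2 mule_ge0 // mule_ge0.
by rewrite !expe2 muleACA -!expe2 L2norm_sqr.
Qed.

(** * The bilinear pairing of L^2 functions *)

Section L2_pairing.
Context d (X : measurableType d) (R : realType) (mu : {measure set X -> \bar R}).
Implicit Types u v : X -> R[i].

Definition sqnorm u : R := \int[mu]_x (normc (u x) ^+ 2).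

Lemma sqnormE u : L2 mu u -> (sqnorm u)%:E = sqint mu u.
Proof.
move=> /L2_lty u2; rewrite /sqnorm /Rintegral fineK //.
by rewrite ge0_fin_numE // sqint_ge0.
Qed.

Lemma integrable_normc_sqr u : L2 mu u ->
  mu.-integrable [set: X] (EFin \o (fun x => normc (u x) ^+ 2)).
Proof.
move=> /L2P[mu_ u2]; apply/integrableP; split; first exact: measurable_sqint.
rewrite (le_lt_trans _ u2) //; apply: ge0_le_integral => //.
- by apply: measurableT_comp => //; exact: measurable_sqint.
- exact: measurable_sqint.
- by move=> x _; rewrite /= ger0_norm ?sqr_ge0.
Qed.

(** Expand (t |z| - |w|)^2 >= 0 and divide by t. This replaces Cauchy-Schwarz: as t is free, the
    bound can be summed over the terms of a series and t fixed afterwards. *)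
Lemma normc_mul_le (z w : R[i]) (t : R) : 0 < t ->
  normc (z * w) <= 2^-1 * (t * normc z ^+ 2 + t^-1 * normc w ^+ 2).
Proof.
move=> t0; rewrite ComplexField.Normc.normcM.
set a := normc z; set b := normc w.
have : 0 <= t^-1 * (t * a - b) ^+ 2 by rewrite mulr_ge0 ?sqr_ge0 // invr_ge0 ltW.
have -> : t^-1 * (t * a - b) ^+ 2 = t * a ^+ 2 + t^-1 * b ^+ 2 - 2 * (a * b).
  by field; rewrite gt_eqF.
lra.
Qed.

(** [p] stands for the real or the imaginary part. *)
Lemma integrable_L2M (p : R[i] -> R) u v :
  (forall z, `|p z| <= normc z) ->
  measurable_fun [set: X] (fun x => p (u x * v x)) ->
  L2 mu u -> L2 mu v -> mu.-integrable [set: X] (EFin \o (fun x => p (u x * v x))).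
Proof.
move=> hp mp hu hv.
apply: (@le_integrable _ _ _ _ _ _ _
  (EFin \o (fun x => normc (u x) ^+ 2 + normc (v x) ^+ 2))).
- by [].
- exact/measurable_EFinP.
- move=> x _; rewrite /= lee_fin (le_trans (hp _)) //.
  rewrite ger0_norm ?addr_ge0 ?sqr_ge0 //.
  have := @normc_mul_le (u x) (v x) 1 ltr01.
  have := sqr_ge0 (normc (u x)); have := sqr_ge0 (normc (v x)); lra.
- exact: (integrableD measurableT (integrable_normc_sqr hu) (integrable_normc_sqr hv)).
Qed.

Lemma integrable_ReM u v : L2 mu u -> L2 mu v ->
  mu.-integrable [set: X] (EFin \o (fun x => Re (u x * v x))).
Proof.
move=> hu hv; apply: (integrable_L2M (p := @complex.Re R)) => //.
- exact: normr_Re_le.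
- by have [] := cmeasurableM (L2_cmeasurable hu) (L2_cmeasurable hv).
Qed.

Lemma integrable_ImM u v : L2 mu u -> L2 mu v ->
  mu.-integrable [set: X] (EFin \o (fun x => Im (u x * v x))).
Proof.
move=> hu hv; apply: (integrable_L2M (p := @complex.Im R)) => //.
- exact: normr_Im_le.
- by have [] := cmeasurableM (L2_cmeasurable hu) (L2_cmeasurable hv).
Qed.

Lemma normr_RintegralM_le (p : R[i] -> R) u v (t : R) : 0 < t ->
  (forall z, `|p z| <= normc z) ->
  mu.-integrable [set: X] (EFin \o (fun x => p (u x * v x))) ->
  L2 mu u -> L2 mu v ->
  `|\int[mu]_x p (u x * v x)| <= 2^-1 * (t * sqnorm u + t^-1 * sqnorm v).
Proof.
move=> t0 hp ip hu hv.
have iu := integrable_normc_sqr hu; have iv := integrable_normc_sqr hv.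
have itu : mu.-integrable [set: X] (EFin \o (fun x => t * normc (u x) ^+ 2)).
  exact: (integrableZl measurableT t iu).
have itv : mu.-integrable [set: X] (EFin \o (fun x => t^-1 * normc (v x) ^+ 2)).
  exact: (integrableZl measurableT t^-1 iv).
have iuv : mu.-integrable [set: X]
    (EFin \o (fun x => t * normc (u x) ^+ 2 + t^-1 * normc (v x) ^+ 2)).
  exact: (integrableD measurableT itu itv).
rewrite /sqnorm -!RintegralZl // -RintegralD // -RintegralZl //.
rewrite (le_trans (le_normr_Rintegral _ ip)) //.
apply: le_Rintegral => //.
- exact: (integrable_abse ip).
- exact: (integrableZl measurableT _ iuv).
- by move=> x _; rewrite (le_trans (hp _)) // normc_mul_le.
Qed.

(** There is no conjugation, hence linearity in both arguments: this is (u, conj v), the form in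
    which the duality between operators and tensors is stated. *)
Definition cpairing u v : R[i] := cintegral mu (fun x => u x * v x).

Lemma L2inner_conj u v : L2inner mu u (fun x => (v x)^*) = cpairing u v.
Proof. by rewrite /L2inner; under eq_fun do rewrite conjCK. Qed.

Lemma normc_cpairing u v (t : R) : 0 < t -> L2 mu u -> L2 mu v ->
  normc (cpairing u v) <= t * sqnorm u + t^-1 * sqnorm v.
Proof.
move=> t0 hu hv; rewrite (le_trans (normc_le_ReIm _)) //=.
have h1 := normr_RintegralM_le t0 (@normr_Re_le R) (integrable_ReM hu hv) hu hv.
have h2 := normr_RintegralM_le t0 (@normr_Im_le R) (integrable_ImM hu hv) hu hv.
by rewrite (le_trans (lerD h1 h2)) // -mulrDl -[2^-1]div1r -splitr mul1r.
Qed.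

Lemma cpairingC u v : cpairing u v = cpairing v u.
Proof. by rewrite /cpairing; under eq_fun do rewrite mulrC. Qed.

Lemma cpairingDl u u' v : L2 mu u -> L2 mu u' -> L2 mu v ->
  cpairing (fun x => u x + u' x) v = cpairing u v + cpairing u' v.
Proof.
move=> hu hu' hv; rewrite /cpairing /cintegral; apply: complexP => /=.
  under eq_Rintegral do rewrite mulrDl Re_addc.
  by rewrite RintegralD //; exact: integrable_ReM.
under eq_Rintegral do rewrite mulrDl Im_addc.
by rewrite RintegralD //; exact: integrable_ImM.
Qed.

Lemma cpairingZl a u v : L2 mu u -> L2 mu v ->
  cpairing (fun x => a * u x) v = a * cpairing u v.
Proof.
move=> hu hv; rewrite /cpairing /cintegral.
have iR := integrable_ReM hu hv; have iI := integrable_ImM hu hv.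
have hZ (c : R) w : mu.-integrable [set: X] (EFin \o w) ->
    mu.-integrable [set: X] (EFin \o (fun x => c * w x)).
  exact: integrableZl.
apply: complexP => /=.
  under eq_Rintegral do rewrite -mulrA Re_mulc.
  by rewrite RintegralB ?(RintegralZl _ measurableT iR)
    ?(RintegralZl _ measurableT iI) ?Re_mulc //; exact: hZ.
under eq_Rintegral do rewrite -mulrA Im_mulc.
by rewrite RintegralD ?(RintegralZl _ measurableT iR)
  ?(RintegralZl _ measurableT iI) ?Im_mulc //; exact: hZ.
Qed.

Lemma ae_eq_cpairing u u' v : L2 mu u -> L2 mu u' -> L2 mu v ->
  u = u' %[ae mu] -> cpairing u v = cpairing u' v.
Proof.
move=> hu hu' hv uu'; rewrite /cpairing /cintegral.
have [m1 m2] := cmeasurableM (L2_cmeasurable hu) (L2_cmeasurable hv).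
have [m3 m4] := cmeasurableM (L2_cmeasurable hu') (L2_cmeasurable hv).
congr (_ +i* _)%C; congr fine; apply: ae_eq_integral => //;
  try exact/measurable_EFinP.
- by apply: filterS uu' => x /= h /h ->.
- by apply: filterS uu' => x /= h /h ->.
Qed.

Lemma cpairing_mulchi (A : set X) u v :
  cpairing (mulchi A u) v = cpairing u (mulchi A v).
Proof.
rewrite /cpairing; congr cintegral; apply/funext => x.
by rewrite /mulchi mulrCA mulrA.
Qed.

Lemma cpairing_conj u : L2 mu u -> cpairing u (fun x => (u x)^*) = 0 ->
  u = (fun=> 0) %[ae mu].
Proof.
move=> hu h; apply: (sqint_eq0 (L2_cmeasurable hu)).
rewrite -sqnormE //; congr (_%:E).
rewrite -[RHS](congr1 (@complex.Re R) h) /= /sqnorm.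
apply: eq_Rintegral => x _; rewrite conj_conjc normc_sqr; case: (u x) => a b /=.
by rewrite mulrN opprK !expr2.
Qed.

End L2_pairing.

(** * Square summable sequences as elements of L^2(l^2) *)

Section square_summable_theory.
Context d (X : measurableType d) (R : realType) (mu : {measure set X -> \bar R}).
Implicit Types f g : nat -> X -> R[i].
Local Open Scope ereal_scope.

(** The squared l^2 norm of the value of f = (f_k)_k at x; its integral is the squared norm of f in
    L^2(l^2). *)
Definition pointwise_sqsum f x : \bar R :=
  \sum_(0 <= k <oo) (normc (f k x) ^+ 2)%:E.

Lemma pointwise_sqsum_ge0 f x : 0 <= pointwise_sqsum f x.
Proof. by apply: nneseries_ge0 => k _ _; rewrite lee_fin sqr_ge0. Qed.

Lemma measurable_pointwise_sqsum f : (forall k, cmeasurable (f k)) ->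
  measurable_fun [set: X] (pointwise_sqsum f).
Proof.
move=> mf; apply: (ge0_emeasurable_sum (P := xpredT)) => //.
- by move=> k x _ _; rewrite lee_fin sqr_ge0.
- by move=> k _; exact: measurable_sqint.
Qed.

Lemma integral_pointwise_sqsum f E : (forall k, cmeasurable (f k)) ->
  measurable E ->
  \int[mu]_(x in E) pointwise_sqsum f x =
  \sum_(0 <= k <oo) sqint mu (mulchi E (f k)).
Proof.
move=> mf mE; rewrite /pointwise_sqsum integral_nneseries //.
- by apply: eq_eseriesr => k _; rewrite sqint_mulchi.
- by move=> k; apply: measurable_funTS; exact: measurable_sqint.
- by move=> k x _; rewrite lee_fin sqr_ge0.
Qed.

Lemma square_summableP f : square_summable mu f <->
  (forall k, L2 mu (f k)) /\ \int[mu]_x pointwise_sqsum f x < +oo.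
Proof.
have h : (forall k, L2 mu (f k)) -> \sum_(0 <= n <oo) L2norm mu (f n) ^+ 2 =
    \int[mu]_x pointwise_sqsum f x.
  move=> L; rewrite integral_pointwise_sqsum // => [|k].
    by apply: eq_eseriesr => k _; rewrite mulchiT L2norm_sqr.
  exact: L2_cmeasurable (L k).
rewrite /square_summable; split=> -[L hs]; split=> //.
  by rewrite -(h L); exact: hs.
by rewrite -(h L) in hs; exact: hs.
Qed.

Lemma sum_sqnorm_mulchi f E N : square_summable mu f -> measurable E ->
  (\sum_(0 <= k < N) sqnorm mu (mulchi E (f k)))%:E <=
  \int[mu]_(x in E) pointwise_sqsum f x.
Proof.
move=> /square_summableP[L _] mE.
rewrite integral_pointwise_sqsum //; last by move=> k; exact: L2_cmeasurable (L k).
rewrite -sumEFin (eq_bigr (fun k => sqint mu (mulchi E (f k)))) => [|k _]; last first.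
  by rewrite sqnormE //; exact: L2_mulchi.
by apply: nneseries_lim_ge => k _ _; exact: sqint_ge0.
Qed.

Lemma square_summable_bound f : square_summable mu f ->
  exists2 B : R, (0 <= B)%R &
    forall N, (\sum_(0 <= k < N) sqnorm mu (f k) <= B)%R.
Proof.
move=> sf; have [L foo] := (square_summableP f).1 sf.
have f0 : 0 <= \int[mu]_x pointwise_sqsum f x.
  by apply: integral_ge0 => x _; exact: pointwise_sqsum_ge0.
exists (fine (\int[mu]_x pointwise_sqsum f x)); first exact: fine_ge0.
move=> N; rewrite -lee_fin fineK ?ge0_fin_numE //.
rewrite (le_trans _ (sum_sqnorm_mulchi N sf measurableT)) //.
by rewrite lee_fin; apply: ler_sum => k _; rewrite mulchiT.
Qed.

(** By monotone convergence the integrals of [pointwise_sqsum f] over the [A n] increase to the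
    total integral, which is finite; so what is left outside [A n] becomes small. *)
Lemma square_summable_exhaust f (A : nat -> set X) (e : R) :
  square_summable mu f -> (0 < e)%R -> (forall n, measurable (A n)) ->
  nondecreasing_seq A -> mu (~` \bigcup_n A n) = 0 ->
  exists n, \int[mu]_(x in ~` A n) pointwise_sqsum f x <= e%:E.
Proof.
move=> sf e0 mA ndA muA; have [L foo] := (square_summableP f).1 sf.
have mf : measurable_fun [set: X] (pointwise_sqsum f).
  by apply: measurable_pointwise_sqsum => k; exact: L2_cmeasurable (L k).
have f0 x : 0 <= pointwise_sqsum f x by exact: pointwise_sqsum_ge0.
have mU : measurable (\bigcup_n A n) by exact: bigcup_measurable.
have split_int E : measurable E -> \int[mu]_x pointwise_sqsum f x =
    \int[mu]_(x in E) pointwise_sqsum f x + \int[mu]_(x in ~` E) pointwise_sqsum f x.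
  move=> mE; rewrite -ge0_integral_setU ?setUv //.
  - exact: measurableC.
  - by apply/disj_setPS; rewrite setICr.
have UT : \int[mu]_(x in \bigcup_n A n) pointwise_sqsum f x = \int[mu]_x pointwise_sqsum f x.
  rewrite (split_int _ mU) [X in _ = _ + X]null_set_integral ?adde0 //.
  - exact: measurableC.
  - exact: measurable_funTS.
have := @ge0_nondecreasing_set_cvg_integral _ _ _ A _ mu ndA mA
  (fun=> measurable_funTS mf) (fun i x _ => f0 x).
rewrite UT => cvI.
have cvS := @ereal_nondecreasing_cvgn R _ (ge0_nondecreasing_set_nondecreasing_integral
  mu ndA mA (fun=> measurable_funTS mf) (fun i x _ => f0 x)).
have IS := cvg_unique (@ereal_hausdorff R) cvI cvS.
have Ifin : \int[mu]_x pointwise_sqsum f x \is a fin_num.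
  by rewrite ge0_fin_numE // integral_ge0.
have : \int[mu]_x pointwise_sqsum f x - e%:E < \int[mu]_x pointwise_sqsum f x.
  by rewrite lteBlDr // lteDl // lte_fin.
rewrite [X in _ < X]IS => hlt.
have [_ [n _ <-] hn] := ereal_sup_gt hlt; exists n.
move: hn; rewrite lteBlDr // (split_int _ (mA n)).
have In : \int[mu]_(x in A n) pointwise_sqsum f x \is a fin_num.
  rewrite ge0_fin_numE ?integral_ge0 //.
  by rewrite (le_lt_trans _ foo) // ge0_subset_integral.
by rewrite lteD2lE // => /ltW.
Qed.

(** Absolute continuity of the integral, applied to the real-valued function [fine] of the pointwise
    sum, which agrees with that sum almost everywhere because the sum is integrable. *)
Lemma square_summable_ac f (e : R) : square_summable mu f -> (0 < e)%R ->
  exists2 r : R, (0 < r)%R & forall E, measurable E -> mu E < r%:E ->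
    \int[mu]_(x in E) pointwise_sqsum f x <= e%:E.
Proof.
move=> sf e0; have [L foo] := (square_summableP f).1 sf.
have mf : measurable_fun [set: X] (pointwise_sqsum f).
  by apply: measurable_pointwise_sqsum => k; exact: L2_cmeasurable (L k).
have f0 x : 0 <= pointwise_sqsum f x by exact: pointwise_sqsum_ge0.
have fi : mu.-integrable [set: X] (pointwise_sqsum f).
  apply/integrableP; split => //.
  by under eq_integral do rewrite gee0_abs //.
have aef := integrable_ae measurableT fi.
have aee : ae_eq mu setT (pointwise_sqsum f) (EFin \o fine \o pointwise_sqsum f).
  by apply: filterS aef => x /= /(_ Logic.I) h _; rewrite fineK.
have fi' : mu.-integrable [set: X] (EFin \o (fine \o pointwise_sqsum f)).
  have mff : measurable_fun [set: X] (EFin \o (fine \o pointwise_sqsum f)).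
    by apply/measurable_EFinP; exact: measurableT_comp.
  apply/integrableP; split => //; rewrite (le_lt_trans _ foo) //.
  rewrite (@ae_eq_integral _ _ _ mu setT (pointwise_sqsum f)) //.
    exact: measurableT_comp.
  by apply: filterS aee => x /= /(_ Logic.I) h _; rewrite ger0_norm ?fine_ge0 // -h.
have [r [r0 hr]] := integral_normr_continuous fi' e0.
exists r => // E mE Er; apply/ltW; have := hr E mE Er.
rewrite /Rintegral -lte_fin.
rewrite (@ae_eq_integral _ _ _ mu E (pointwise_sqsum f)) //.
- rewrite fineK // ge0_fin_numE ?integral_ge0 //.
  by apply: (le_lt_trans _ foo); apply: ge0_subset_integral.
- apply/measurable_EFinP; apply: measurableT_comp => //.
  by apply: measurable_funTS; exact: measurableT_comp.
- exact: measurable_funTS.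
- by apply: filterS aee => x /= /(_ Logic.I) h _; rewrite ger0_norm ?fine_ge0 // -h.
Qed.

End square_summable_theory.

(** * Bounded bilinear forms *)

Section bounded_bilinear.
Context dX (X : measurableType dX) dY (Y : measurableType dY) (R : realType).
Variables (mu : {measure set X -> \bar R}) (nu : {measure set Y -> \bar R}).

(** Optimising over [t] turns the last clause into the usual bound by 2 sqrt(C) times the product of
    the norms; the unoptimised form is the one that can be summed. For an operator bounded by c the
    constant [C] is c^2. *)
Definition bounded_bilinear (b : (X -> R[i]) -> (Y -> R[i]) -> R[i]) :=
  [/\ forall a f f' g, L2 mu f -> L2 mu f' -> L2 nu g ->
        b (fun x => a * f x + f' x) g = a * b f g + b f' g,
      forall a f g g', L2 mu f -> L2 nu g -> L2 nu g' ->
        b f (fun y => a * g y + g' y) = a * b f g + b f g' &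
      exists2 C : R, 0 <= C & forall t f g, 0 < t -> L2 mu f -> L2 nu g ->
        normc (b f g) <= t * C * sqnorm mu f + t^-1 * sqnorm nu g].

Lemma bounded_operator_bilinear T : bounded_operator mu nu T ->
  bounded_bilinear (fun f g => cpairing nu (T f) g).
Proof.
move=> [TL2 Tae Tlin [C TC]]; split.
- move=> a f f' g hf hf' hg.
  have haf : L2 nu (fun y => a * T f y) by apply: L2Z; exact: TL2.
  rewrite (ae_eq_cpairing _ _ hg (Tlin a f f' hf hf')).
  + by rewrite cpairingDl ?cpairingZl //; exact: TL2.
  + by apply: TL2; apply: L2D => //; exact: L2Z.
  + by apply: L2D => //; exact: TL2.
- move=> a f g g' hf hg hg'; have hTf := TL2 f hf.
  rewrite ![cpairing nu (T f) _]cpairingC cpairingDl ?cpairingZl //; exact: L2Z.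
- exists (C ^+ 2); first exact: sqr_ge0.
  move=> t f g t0 hf hg; have hTf := TL2 f hf.
  rewrite (le_trans (normc_cpairing t0 hTf hg)) // lerD2r -mulrA ler_wpM2l ?(ltW t0) //.
  rewrite -lee_fin EFinM !sqnormE // -!L2norm_sqr !expe2.
  have n0 : (0 <= L2norm nu (T f))%E by exact: Lnorm_ge0.
  by rewrite EFinM muleACA; apply: lee_pmul => //; exact: TC.
Qed.

Variable b : (X -> R[i]) -> (Y -> R[i]) -> R[i].
Hypothesis hb : bounded_bilinear b.

Lemma bilinear0l g : L2 nu g -> b (fun=> 0) g = 0.
Proof.
case: hb => bl _ _ hg; have := bl 1 _ _ g (L2_0 mu) (L2_0 mu) hg.
under [X in b X _]eq_fun do rewrite mulr0 addr0.
by rewrite mul1r => /esym/eqP; rewrite -subr_eq0 addrK => /eqP.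
Qed.

Lemma bilinear0r f : L2 mu f -> b f (fun=> 0) = 0.
Proof.
case: hb => _ br _ hf; have := br 1 f _ _ hf (L2_0 nu) (L2_0 nu).
under [X in b _ X]eq_fun do rewrite mulr0 addr0.
by rewrite mul1r => /esym/eqP; rewrite -subr_eq0 addrK => /eqP.
Qed.

Lemma bilinear_suml (I : Type) (r : seq I) (a : I -> R[i]) (F : I -> X -> R[i]) g :
  (forall i, L2 mu (F i)) -> L2 nu g ->
  b (fun x => \sum_(i <- r) a i * F i x) g = \sum_(i <- r) a i * b (F i) g.
Proof.
move=> hF hg; elim: r => [|i r IH].
  by under [X in b X _]eq_fun do rewrite big_nil; rewrite big_nil bilinear0l.
under [X in b X _]eq_fun do rewrite big_cons.
case: hb => bl _ _; rewrite bl ?big_cons ?IH //.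
by apply: L2_sum => j; exact: L2Z.
Qed.

Lemma bilinear_sumr (I : Type) (r : seq I) (a : I -> R[i]) f (G : I -> Y -> R[i]) :
  L2 mu f -> (forall i, L2 nu (G i)) ->
  b f (fun y => \sum_(i <- r) a i * G i y) = \sum_(i <- r) a i * b f (G i).
Proof.
move=> hf hG; elim: r => [|i r IH].
  by under [X in b _ X]eq_fun do rewrite big_nil; rewrite big_nil bilinear0r.
under [X in b _ X]eq_fun do rewrite big_cons.
case: hb => _ br _; rewrite br ?big_cons ?IH //.
by apply: L2_sum => j; exact: L2Z.
Qed.

Lemma bilinearBl f f' g : L2 mu f -> L2 mu f' -> L2 nu g ->
  b (fun x => f x - f' x) g = b f g - b f' g.
Proof.
move=> hf hf' hg; case: hb => bl _ _.
rewrite addrC -mulN1r -bl //; congr (b _ g).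
by apply/funext => x; rewrite mulN1r addrC.
Qed.

Lemma bilinearBr f g g' : L2 mu f -> L2 nu g -> L2 nu g' ->
  b f (fun y => g y - g' y) = b f g - b f g'.
Proof.
move=> hf hg hg'; case: hb => _ br _.
rewrite addrC -mulN1r -br //; congr (b f _).
by apply/funext => x; rewrite mulN1r addrC.
Qed.

Lemma L2B f f' : L2 mu f -> L2 mu f' -> L2 mu (fun x => f x - f' x).
Proof.
move=> hf hf'; have := L2D hf (L2Z (-1) hf').
by congr (L2 mu _); apply/funext => x; rewrite mulN1r.
Qed.

Lemma sqnorm_le_sub f f' : L2 mu f -> L2 mu f' ->
  sqnorm mu f' <= 2 * sqnorm mu f + 2 * sqnorm mu (fun x => f x - f' x).
Proof.
move=> hf hf'; have hB := L2B hf hf'.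
rewrite -lee_fin EFinD !EFinM !sqnormE //.
have mB := L2_cmeasurable (L2Z (-1) hB).
have := sqintD mu (L2_cmeasurable hf) mB.
rewrite sqintZ; last exact: L2_cmeasurable hB.
rewrite (_ : normc (-1) ^+ 2 = 1); last by rewrite normc_sqr /=; ring.
rewrite mul1e; congr (_ <= _)%E; congr (sqint mu _).
by apply/funext => x; ring.
Qed.

End bounded_bilinear.

(* The partial sums depend continuously, uniformly in their number of terms, on
   the sequences for the norm of L^2(l^2). *)
Lemma null_pairing_approx dX (X : measurableType dX) dY (Y : measurableType dY)
    (R : realType) (mu : {measure set X -> \bar R}) (nu : {measure set Y -> \bar R})
    (b : (X -> R[i]) -> (Y -> R[i]) -> R[i]) f g :
  bounded_bilinear mu nu b -> square_summable mu f -> square_summable nu g ->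
  (forall e : R, 0 < e -> exists f' g',
    [/\ forall k, L2 mu (f' k), forall k, L2 nu (g' k),
     forall N, \sum_(0 <= k < N) sqnorm mu (fun x => f k x - f' k x) <= e,
     forall N, \sum_(0 <= k < N) sqnorm nu (fun y => g k y - g' k y) <= e &
     null_seq (fun n => \sum_(0 <= k < n) b (f' k) (g' k))]) ->
  null_seq (fun n => \sum_(0 <= k < n) b (f k) (g k)).
Proof.
move=> hb sf sg happ; have [_ _ [C C0 bC]] := hb.
have [Lf _] := sf; have [Lg _] := sg.
have [A A0 hA] := square_summable_bound sf.
have [B B0 hB] := square_summable_bound sg.
apply/null_seqP => e e0.
(* The error is the sum of b(f - f', g) and b(f', g - g'). The first is estimated with a large
   weight [t], which makes B / t at most e/8; the second with a small weight [s], which tames the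
   term in A. Only then is [d] chosen, so that the remaining two terms are at most e/8 each; d <= 1
   keeps the norm of f' below a bound depending on A alone. *)
pose t := 8 * (B + 1) / e; pose s := e / (8 * (C + 1) * (2 * A + 2)).
have t0 : 0 < t by rewrite divr_gt0 //; lra.
have s0 : 0 < s by rewrite divr_gt0 // mulr_gt0 //; lra.
pose d := Num.min 1 (Num.min (e / (8 * (C + 1) * t)) (s * e / 8)).
have d0 : 0 < d.
  have C1 : 0 < C + 1 by lra.
  rewrite !lt_min ltr01 /=; apply/andP; split; last by rewrite divr_gt0 // mulr_gt0.
  by rewrite divr_gt0 // mulr_gt0 // mulr_gt0.
have d1 : d <= 1 by rewrite /d ge_min lexx.
have d2 : d <= e / (8 * (C + 1) * t) by rewrite /d !ge_min lexx orbT.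
have d3 : d <= s * e / 8 by rewrite /d !ge_min lexx !orbT.
have [f' [g' [Lf' Lg' hf' hg' /null_seqP hn]]] := happ d d0.
have [N hN] := hn _ (divr_gt0 e0 (ltr0n _ 2)).
exists N => n Nn.
have -> : \sum_(0 <= k < n) b (f k) (g k) = \sum_(0 <= k < n) b (f' k) (g' k) +
    (\sum_(0 <= k < n) b (fun x => f k x - f' k x) (g k) +
     \sum_(0 <= k < n) b (f' k) (fun y => g k y - g' k y)).
  rewrite -!big_split /=; apply: eq_bigr => k _.
  by rewrite (bilinearBl hb) ?(bilinearBr hb) //; ring.
have h1 : normc (\sum_(0 <= k < n) b (fun x => f k x - f' k x) (g k)) <=
    t * C * d + t^-1 * B.
  rewrite (le_trans (normc_sum _ _)) //.
  rewrite (@le_trans _ _ (\sum_(0 <= k < n) (t * C * sqnorm mu (fun x => f k x - f' k x)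
    + t^-1 * sqnorm nu (g k)))) //.
    by apply: ler_sum => k _; apply: bC => //; exact: L2B.
  rewrite big_split /= -!mulr_sumr; apply: lerD.
    by apply: ler_wpM2l => //; rewrite mulr_ge0 ?(ltW t0).
  by apply: ler_wpM2l => //; rewrite invr_ge0 ltW.
have h2 : normc (\sum_(0 <= k < n) b (f' k) (fun y => g k y - g' k y)) <=
    s * C * (2 * A + 2 * d) + s^-1 * d.
  rewrite (le_trans (normc_sum _ _)) //.
  rewrite (@le_trans _ _ (\sum_(0 <= k < n) (s * C * (2 * sqnorm mu (f k) +
    2 * sqnorm mu (fun x => f k x - f' k x))
    + s^-1 * sqnorm nu (fun y => g k y - g' k y)))) //.
    apply: ler_sum => k _; rewrite (le_trans (bC s _ _ s0 _ _)) //; first exact: L2B.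
    rewrite lerD2r; apply: ler_wpM2l; first by rewrite mulr_ge0 ?(ltW s0).
    exact: sqnorm_le_sub.
  rewrite big_split /= -!mulr_sumr big_split /= -!mulr_sumr lerD //.
    apply: ler_wpM2l; first by rewrite mulr_ge0 ?(ltW s0).
    by apply: lerD; apply: ler_wpM2l.
  by apply: ler_wpM2l; rewrite ?invr_ge0 ?(ltW s0).
have b1 : t * C * d <= e / 8.
  rewrite (@le_trans _ _ (t * (C + 1) * d)) //.
    by rewrite ler_wpM2r ?(ltW d0) // ler_wpM2l ?(ltW t0) // lerDl.
  have -> : e / 8 = t * (C + 1) * (e / (8 * (C + 1) * t)).
    by field; rewrite !gt_eqF //; lra.
  by apply: ler_wpM2l => //; rewrite mulr_ge0 ?(ltW t0) ?addr_ge0.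
have b2 : t^-1 * B <= e / 8.
  rewrite /t invf_div mulrAC ler_pdivrMr; last lra.
  have -> : e / 8 * (8 * (B + 1)) = e * B + e by field.
  by rewrite lerDl ltW.
have b3 : s * C * (2 * A + 2 * d) <= e / 8.
  have -> : e / 8 = s * (C + 1) * (2 * A + 2).
    rewrite /s; field; apply/andP; split; rewrite gt_eqF //; lra.
  apply: ler_pM.
  - by rewrite mulr_ge0 ?(ltW s0).
  - by rewrite addr_ge0 // mulr_ge0 // ltW.
  - by apply: ler_wpM2l; rewrite ?(ltW s0) // lerDl.
  - by rewrite lerD2l; lra.
have b4 : s^-1 * d <= e / 8.
  by rewrite mulrC ler_pdivrMr // (le_trans d3) //; lra.
set S1 := \sum_(0 <= k < n) b (f' k) (g' k).
set S2 := \sum_(0 <= k < n) b (fun x => f k x - f' k x) (g k).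
set S3 := \sum_(0 <= k < n) b (f' k) (fun y => g k y - g' k y).
have := le_normcD S1 (S2 + S3); have := le_normcD S2 S3.
have := hN n Nn; rewrite -/S1; rewrite -/S2 in h1; rewrite -/S3 in h2. lra.
Qed.

(** * Approximation by step functions and the zero pairing *)

Lemma ge0_integral_setU_le d (X : measurableType d) (R : realType)
    (mu : {measure set X -> \bar R}) (A B : set X) (f : X -> \bar R) :
  measurable A -> measurable B -> measurable_fun [set: X] f ->
  (forall x, 0 <= f x)%E ->
  (\int[mu]_(x in A `|` B) f x <= \int[mu]_(x in A) f x + \int[mu]_(x in B) f x)%E.
Proof.
move=> mA mB mf f0.
have -> : A `|` B = A `|` (B `\` A).
  apply/seteqP; split => x [Ax|Bx]; [by left| |by left|by right; case: Bx].
  by have [Ax|nAx] := pselect (A x); [left|right].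
have mBA : measurable (B `\` A) by exact: measurableD.
rewrite ge0_integral_setU //.
- by apply: leeD => //; apply: ge0_subset_integral => //; exact: measurable_funTS.
- exact: measurable_funTS.
- by apply/disj_setPS => x [Ax []].
Qed.

Section range_approximation.
Context d (X : measurableType d) (R : realType) (mu : {measure set X -> \bar R}).
Implicit Types f : nat -> X -> R[i].

(** A countable dense subset of l^2: finitely supported sequences of Gaussian rationals, enumerated
    by [pickle]. Entries beyond the list are 0, and an index that decodes to nothing gives the zero
    sequence. *)
Definition rational_code (j k : nat) : R[i] :=
  let s := odflt [::] (unpickle j : option (seq (rat * rat))) in
  let q := nth (0, 0) s k in (ratr q.1 +i* ratr q.2)%C.

Lemma rational_dense (z : R[i]) (e : R) : 0 < e ->
  exists q : rat * rat, normc (z - (ratr q.1 +i* ratr q.2)%C) ^+ 2 <= e.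
Proof.
move=> e0; case: z => a b; pose r := Num.min 1 (e / 2).
have r0 : 0 < r by rewrite lt_min ltr01 divr_gt0.
have r1 : r <= 1 by rewrite /r ge_min lexx.
have r2 : r <= e / 2 by rewrite /r ge_min lexx orbT.
have near_rat (x : R) : exists q : rat, (x - ratr q) ^+ 2 <= r.
  have [q] := @rat_in_itvoo R (x - r) (x + r) ltac:(lra).
  rewrite in_itv /= => /andP[q1 q2]; exists q; nra.
have [p hp] := near_rat a; have [q hq] := near_rat b.
exists (p, q); rewrite normc_sqr /=; lra.
Qed.

Lemma rational_code_dense (z : nat -> R[i]) (e : R) : 0 < e ->
  (\sum_(0 <= k <oo) (normc (z k) ^+ 2)%:E < +oo)%E ->
  exists j, (\sum_(0 <= k <oo) (normc (z k - rational_code j k) ^+ 2)%:E < e%:E)%E.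
Proof.
move=> e0 zoo.
have tail0 : (\sum_(N <= k <oo) (normc (z k) ^+ 2)%:E @[N --> \oo] --> 0)%E.
  by apply: nneseries_tail_cvg => // k _; rewrite lee_fin sqr_ge0.
have [N hN] : exists N, (\sum_(N <= k <oo) (normc (z k) ^+ 2)%:E < (e / 2)%:E)%E.
  have e2 : (0 < (e / 2)%:E)%E by rewrite lte_fin divr_gt0.
  have [N _ hN] := tail0 _ (open_nbhs_nbhs (conj (@open_ereal_lt_ereal _ (e / 2)%:E) e2)).
  by exists N; exact: hN (leqnn N).
(* The tail from N on is already below e/2 and is left uncoded; the N remaining entries contribute
   at most N c <= e/4. Using N + 1 covers N = 0. *)
pose c := e / (4 * N.+1%:R).
have c0 : 0 < c by rewrite divr_gt0 // mulr_gt0 // ltr0n.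
have /choice[q hq] := fun k => rational_dense (z k) c0.
pose j := pickle [seq q k | k <- iota 0 N].
have jE k : rational_code j k = if (k < N)%N then (ratr (q k).1 +i* ratr (q k).2)%C else 0.
  rewrite /rational_code pickleK /=; case: ltnP => kN.
    by rewrite (nth_map 0%N) ?size_iota // nth_iota.
  by rewrite nth_default ?size_map ?size_iota //= rmorph0.
exists j; rewrite (nneseries_split 0 N); last by move=> k _; rewrite lee_fin sqr_ge0.
rewrite add0n.
have h2 : (\sum_(N <= k <oo) (normc (z k - rational_code j k) ^+ 2)%:E < (e / 2)%:E)%E.
  rewrite (_ : (\sum_(N <= k <oo) _)%E = (\sum_(N <= k <oo) (normc (z k) ^+ 2)%:E)%E) //.
  congr (limn _); apply/funext => n; apply: eq_big_nat => k /andP[Nk _].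
  by rewrite jE ltnNge Nk subr0.
have h1 : (\sum_(0 <= k < N) (normc (z k - rational_code j k) ^+ 2)%:E <= (e / 2)%:E)%E.
  rewrite sumEFin lee_fin.
  rewrite (@le_trans _ _ (\sum_(0 <= k < N) c)) //.
    by rewrite !big_mkord; apply: ler_sum => k _; rewrite jE ltn_ord.
  rewrite sumr_const_nat subn0 -[c *+ N]mulr_natr.
  have N0 : 0 < N.+1%:R :> R by rewrite ltr0n.
  have NN : N%:R <= N.+1%:R :> R by rewrite ler_nat.
  rewrite (@le_trans _ _ (c * N.+1%:R)) // ?ler_wpM2l ?(ltW c0) //.
  have -> : c * N.+1%:R = e / 4 by rewrite /c; field; rewrite gt_eqF.
  lra.
rewrite [e in ltRHS]splitr EFinD; apply: (le_lt_trans (leeD2r _ h1)); by rewrite lteD2lE.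
Qed.

(* [fun x => (f k x)_k] is approximated in L^2(l^2) by step functions taking
   values of [f] itself, at points that avoid a prescribed null set. *)
Lemma square_summable_range_approx f (N0 : set X) (e : R) :
  sigma_finite [set: X] mu -> square_summable mu f ->
  measurable N0 -> mu N0 = 0%E -> 0 < e ->
  exists (n : nat) (A : 'I_n -> set X) (p : 'I_n -> X),
    (forall m, [/\ measurable (A m), (mu (A m) < +oo)%E & ~ N0 (p m)]) /\
    forall N, \sum_(0 <= k < N) sqnorm mu (fun x => f k x -
      \sum_(m < n) f k (p m) * mulchi (A m) (fun=> 1) x) <= e.
Proof.
move=> sfin sf mN0 N00 e0.
have [L foo] := (square_summableP mu f).1 sf.
have mf : measurable_fun [set: X] (pointwise_sqsum f).
  by apply: measurable_pointwise_sqsum => k; exact: L2_cmeasurable (L k).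
(* If [N0] is the whole space there is no admissible point, but then the space is null and the empty
   step function serves. *)
have [[x0 Nx0]|noX] := pselect (exists x, ~ N0 x); last first.
  have N0T : N0 = setT.
    by apply/seteqP; split => // x _; apply: contrapT => h; apply: noX; exists x.
  exists 0%N, (fun=> setT), (fun=> point); split; first by case.
  move=> N; rewrite big1 ?(ltW e0) // => k _.
  rewrite /sqnorm /Rintegral null_set_integral //.
    apply: measurable_sqint; apply: cmeasurableD; first exact: L2_cmeasurable (L k).
    by under eq_fun do rewrite big_ord0 oppr0; exact: cmeasurable_cst.
  by rewrite -N0T.
have [Z0 [Z0T ndZ mZ]] := (sigma_finiteP _ _).1 sfin.
have e3 : 0 < e / 3 by lra.
have [i0 hZ] := square_summable_exhaust sf e3 (fun i => (mZ i).1) ndZ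
  ltac:(by rewrite -Z0T setCT measure0).
set Z := Z0 i0 in hZ; have [mZZ Zoo] : measurable Z /\ (mu Z < +oo)%E := mZ i0.
(* The squared error will be at most 4 dl at each point of a part of [Z], so its integral there is
   at most e/3; the other two thirds go to the complement of [Z] and to that of [U n]. *)
pose dl := e / (12 * (fine (mu Z) + 1)).
have muZ0 : 0 <= fine (mu Z) by exact: fine_ge0.
have dl0 : 0 < dl by rewrite divr_gt0 // mulr_gt0 //; lra.
pose dist j x := (\sum_(0 <= k <oo) (normc (f k x - rational_code j k) ^+ 2)%:E)%E.
have mdist j : measurable_fun [set: X] (dist j).
  apply: (@measurable_pointwise_sqsum _ _ _ (fun k x => f k x - rational_code j k)) => k.
  by apply: cmeasurableD; [exact: L2_cmeasurable (L k)|exact: cmeasurable_cst].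
(* Density of the codes makes these sets cover almost every point. Finitely many of them, made
   disjoint and cut by [Z], carry the step function. *)
pose B j := ~` N0 `&` [set x | (dist j x < dl%:E)%E].
have mB j : measurable (B j).
  apply: measurableI; first exact: measurableC.
  rewrite -[X in measurable X]setTI; exact: emeasurable_fun_infty_o.
pose U n := \big[setU/set0]_(j < n) B j.
have mU n : measurable (U n) by exact: bigsetU_measurable.
have ndU : nondecreasing_seq U.
  by move=> i j ij; apply/subsetPset; exact: subset_bigsetU.
have bigU : \bigcup_n B n `<=` \bigcup_n U n.
  by move=> x [j _ Bj]; exists j.+1 => //; rewrite /U big_ord_recr; right.
have muU : mu (~` \bigcup_n U n) = 0%E.
  have fi : mu.-integrable [set: X] (pointwise_sqsum f).
    apply/integrableP; split => //.
    by under eq_integral do rewrite gee0_abs ?pointwise_sqsum_ge0 //.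
  have [N1 [mN1 N10 hN1]] := integrable_ae measurableT fi.
  have mC : measurable (~` \bigcup_n U n).
    by apply: measurableC; exact: bigcup_measurable.
  apply/eqP; rewrite eq_le measure_ge0 andbT.
  rewrite (@le_trans _ _ (mu (N0 `|` N1))) //.
    apply: le_measure; rewrite ?inE //; first exact: measurableU.
    move=> x nU; apply: contrapT => /not_orP[xN0 xN1]; apply: nU; apply: bigU.
    have xoo : (pointwise_sqsum f x < +oo)%E.
      rewrite -ge0_fin_numE ?pointwise_sqsum_ge0 //.
      by apply: contrapT => h; apply: xN1; apply: hN1 => /= /(_ Logic.I).
    by have [j hj] := rational_code_dense dl0 xoo; exists j.
  by rewrite measureU0 // N00.
have [n hU] := square_summable_exhaust sf e3 mU ndU muU.
pose D j := Z `&` seqDU B j.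
have mD j : measurable (D j) by apply: measurableI => //; exact: seqDU_measurable.
(* The value on [D j] is that of f at one of its own points; an empty piece receives the arbitrary
   point [x0]. *)
have p_ex j : exists p, ~ N0 p /\ (D j !=set0 -> D j p).
  have [[p Dp]|nD] := pselect (D j !=set0); last by exists x0.
  have [_ Bp] : Z p /\ seqDU B j p := Dp.
  by exists p; split => //; have [] : (~` N0) p /\ _ := subset_seqDU Bp.
have {p_ex}[p hp] := choice p_ex.
have Doo j : (mu (D j) < +oo)%E.
  apply: (le_lt_trans _ Zoo); apply: le_measure; rewrite ?inE //.
  exact: subIsetl.
exists n, (fun m => D m), (fun m => p m); split.
  by move=> m; split => //; have [] := hp m.
move=> N; pose h k x := f k x - \sum_(m < n) f k (p m) * mulchi (D m) (fun=> 1) x.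
have Lh k : L2 mu (h k).
  by apply: L2B => //; apply: L2_sum => m; apply: L2Z; exact: L2_mulchi_cst.
have hout k x : ~ (Z `&` U n) x -> h k x = f k x.
  move=> nx; rewrite /h big1 ?subr0 // => m _; rewrite mulchiE memNset ?mulr0 // => -[Zx Dx].
  have Bx := subset_seqDU Dx; apply: nx; split => //.
  by rewrite /U (bigD1 m) //; left.
have hin x : (Z `&` U n) x -> exists2 m, D m x & forall k, h k x = f k x - f k (p m).
  move=> [Zx]; rewrite /U bigsetU_seqDU -bigcup_mkord => -[m mn Bx].
  exists m => // k; rewrite /h (bigD1 (Ordinal mn)) //= big1 ?addr0 => [|i im].
    by rewrite mulchiE mem_set ?mulr1.
  rewrite mulchiE memNset ?mulr0 // => -[_ Bi].
  have /trivIsetP := trivIset_seqDU B; move=> /(_ i m Logic.I Logic.I) tr.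
  have : (seqDU B i `&` seqDU B m) x by [].
  rewrite tr //; apply: contra_neq im => im; exact: val_inj.
pose S x := (\sum_(0 <= k < N) normc (h k x) ^+ 2)%:E.
have S0 x : (0 <= S x)%E by rewrite lee_fin sumr_ge0 // => k _; rewrite sqr_ge0.
have mS : measurable_fun [set: X] S.
  apply/measurable_EFinP; apply: measurable_sum => k.
  exact: measurable_normc_sqr (L2_cmeasurable (Lh k)).
have intS : (\int[mu]_x S x = (\sum_(0 <= k < N) sqnorm mu (h k))%:E)%E.
  rewrite -sumEFin /S; under eq_integral do rewrite -sumEFin.
  rewrite ge0_integral_sum //.
  - by apply: eq_bigr => k _; rewrite sqnormE.
  - by move=> k; apply: measurable_sqint; exact: L2_cmeasurable (Lh k).
  - by move=> k x _; rewrite lee_fin sqr_ge0.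
have mUn := mU n; have mG : measurable (Z `&` U n) by exact: measurableI.
have Sin x : (Z `&` U n) x -> (S x <= (4 * dl)%:E)%E.
  move=> /hin[m Dm hx]; rewrite lee_fin /S.
  have bound y : D m y ->
      \sum_(0 <= k < N) normc (f k y - rational_code m k) ^+ 2 <= dl.
    move=> [_ By]; have [_ /= hy] : _ /\ (dist m y < dl%:E)%E := subset_seqDU By.
    rewrite -lee_fin -sumEFin.
    rewrite (le_trans _ (ltW hy)) //; apply: nneseries_lim_ge => k _ _.
    by rewrite lee_fin sqr_ge0.
  have b1 := bound x Dm; have b2 := bound (p m) ((hp m).2 (ex_intro _ x Dm)).
  rewrite (@le_trans _ _ (\sum_(0 <= k < N)
      (2 * normc (f k x - rational_code m k) ^+ 2 +
       2 * normc (f k (p m) - rational_code m k) ^+ 2))) //.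
    apply: ler_sum => k _; rewrite hx.
    (* Both [x] and [p m] lie within dl of the same code, and the square of a sum costs a factor 2,
       whence 4 dl in all. *)
    have -> : f k x - f k (p m) = (f k x - rational_code m k) +
       (-1) * (f k (p m) - rational_code m k) by ring.
    rewrite (le_trans (normc_sqrD _ _)) // ComplexField.Normc.normcM exprMn.
    by rewrite (_ : normc (-1) ^+ 2 = 1) ?mul1r // normc_sqr /=; ring.
  by rewrite big_split /= -!mulr_sumr; lra.
have Sout x : ~ (Z `&` U n) x -> (S x <= pointwise_sqsum f x)%E.
  move=> nx; rewrite /S -sumEFin (eq_bigr (fun k => (normc (f k x) ^+ 2)%:E)).
    by apply: nneseries_lim_ge => k _ _; rewrite lee_fin sqr_ge0.
  by move=> k _; rewrite hout.
have f0 x : (0 <= pointwise_sqsum f x)%E by exact: pointwise_sqsum_ge0.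
rewrite -lee_fin -intS -(setUv (Z `&` U n)) ge0_integral_setU //; last 3 first.
- exact: measurableC.
- by rewrite setUv.
- by apply/disj_setPS; rewrite setICr.
have -> : e = e / 3 + (e / 3 + e / 3) by lra.
rewrite EFinD; apply: leeD.
  rewrite (@le_trans _ _ (\int[mu]_(x in Z `&` U n) (4 * dl)%:E)%E) //.
    by apply: ge0_le_integral => //; exact: measurable_funTS.
  rewrite integral_cst //.
  rewrite (@le_trans _ _ ((4 * dl)%:E * mu Z)%E) //.
    apply: lee_wpmul2l; first by rewrite lee_fin mulr_ge0 ?(ltW dl0).
    by apply: le_measure; rewrite ?inE //; exact: subIsetl.
  rewrite -[mu Z]fineK ?ge0_fin_numE // -EFinM lee_fin.
  have -> : e / 3 = 4 * dl * (fine (mu Z) + 1) by rewrite /dl; field; rewrite gt_eqF //; lra.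
  apply: ler_wpM2l; last by rewrite lerDl.
  by rewrite mulr_ge0 ?(ltW dl0).
have mSf := measurable_funTS (D := ~` (Z `&` U n)) mf.
rewrite setCI EFinD (@le_trans _ _ (\int[mu]_(x in ~` Z `|` ~` U n) pointwise_sqsum f x)%E) //.
  rewrite -setCI; apply: ge0_le_integral => //.
  - exact: measurableC.
  - exact: measurable_funTS.
rewrite (le_trans (ge0_integral_setU_le _ _ _ mf f0)) //; try exact: measurableC.
exact: leeD.
Qed.
End range_approximation.

(** * Marginally null sets *)

Section marginal_sets.
Context dX (X : measurableType dX) dY (Y : measurableType dY) (R : realType).
Variables (mu : {measure set X -> \bar R}) (nu : {measure set Y -> \bar R}).
Implicit Types E F : set (X * Y).

Lemma sub_marginally_null E F : E `<=` F -> marginally_null mu nu F ->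
  marginally_null mu nu E.
Proof.
move=> EF [M [N [hM hN FMN]]]; exists M, N; split => //.
exact: subset_trans EF FMN.
Qed.

Lemma marginally_nullU E F : marginally_null mu nu E -> marginally_null mu nu F ->
  marginally_null mu nu (E `|` F).
Proof.
move=> [M [N [[mM M0] [mN N0] EMN]]] [M' [N' [[mM' M'0] [mN' N'0] FMN]]].
exists (M `|` M'), (N `|` N'); split.
- by split; [exact: measurableU|rewrite measureU0].
- by split; [exact: measurableU|rewrite measureU0].
- move=> [x y] [/EMN|/FMN] [[? ?]|[? ?]].
  + by left; split => //; left.
  + by right; split => //; left.
  + by left; split => //; right.
  + by right; split => //; right.
Qed.

Lemma marginally_aeI (P Q S : X * Y -> Prop) :
  marginally_ae mu nu P -> marginally_ae mu nu Q ->
  (forall p, P p -> Q p -> S p) -> marginally_ae mu nu S.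
Proof.
move=> hP hQ PQS; apply: sub_marginally_null (marginally_nullU hP hQ) => p nS.
by apply: contrapT => /not_orP[/contrapT hp /contrapT hq]; apply: nS; exact: PQS.
Qed.

Lemma marginally_ae_sub (P S : X * Y -> Prop) :
  marginally_ae mu nu P -> (forall p, P p -> S p) -> marginally_ae mu nu S.
Proof. by move=> hP PS; apply: (marginally_aeI hP hP) => p + _; exact: PS. Qed.

End marginal_sets.

Section null_pairing.
Context dX (X : measurableType dX) dY (Y : measurableType dY) (R : realType).
Variables (mu : {measure set X -> \bar R}) (nu : {measure set Y -> \bar R}).
Hypotheses (smu : sigma_finite [set: X] mu) (snu : sigma_finite [set: Y] nu).
Variable b : (X -> R[i]) -> (Y -> R[i]) -> R[i].
Hypothesis hb : bounded_bilinear mu nu b.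

(* The pairing is well defined on functions: for step functions with values
   taken by [f] and [g] it is a finite combination of the values of the sum at
   points outside the exceptional sets. *)
Lemma null_pairing f g : square_summable mu f -> square_summable nu g ->
  marginally_ae mu nu
    (fun p => null_seq (fun n => \sum_(0 <= k < n) f k p.1 * g k p.2)) ->
  null_seq (fun n => \sum_(0 <= k < n) b (f k) (g k)).
Proof.
move=> sf sg [M [N [[mM M0] [mN N0] hMN]]].
apply: (null_pairing_approx hb sf sg) => e e0.
have [m [A [p [hA hf]]]] := square_summable_range_approx smu sf mM M0 e0.
have [l [B [q [hB hg]]]] := square_summable_range_approx snu sg mN N0 e0.
have LA i : L2 mu (mulchi (A i) (fun=> 1 : R[i])).
  by have [? ? _] := hA i; exact: L2_mulchi_cst.
have LB j : L2 nu (mulchi (B j) (fun=> 1 : R[i])).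
  by have [? ? _] := hB j; exact: L2_mulchi_cst.
exists (fun k x => \sum_(i < m) f k (p i) * mulchi (A i) (fun=> 1) x).
exists (fun k y => \sum_(j < l) g k (q j) * mulchi (B j) (fun=> 1) y).
split => //.
- by move=> k; apply: L2_sum => i; exact: L2Z.
- by move=> k; apply: L2_sum => j; exact: L2Z.
rewrite (_ : (fun _ => _) = fun n => \sum_(i < m) \sum_(j < l)
    b (mulchi (A i) (fun=> 1)) (mulchi (B j) (fun=> 1)) *
    \sum_(0 <= k < n) f k (p i) * g k (q j)).
  apply: null_seq_sum => i; apply: null_seq_sum => j; apply: null_seqZ.
  apply: contrapT => hn; have [[hp _]|[_ hq]] := hMN (p i, q j) hn.
    by have [_ _] := hA i.
  by have [_ _] := hB j.
apply/funext => n.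
under [RHS]eq_bigr do under eq_bigr do rewrite mulr_sumr.
under [RHS]eq_bigr do rewrite exchange_big /=.
rewrite [RHS]exchange_big /=; apply: eq_bigr => k _.
rewrite (bilinear_suml hb) //; last by apply: L2_sum => j; exact: L2Z.
apply: eq_bigr => i _; rewrite (bilinear_sumr hb) // mulr_sumr.
by apply: eq_bigr => j _; rewrite mulrA mulrC.
Qed.

End null_pairing.

(** * Rectangles *)

Lemma pushforward_null d d' (X : measurableType d) (X1 : measurableType d')
    (R : realType) (mu : {measure set X -> \bar R}) (mu1 : {measure set X1 -> \bar R})
    (phi : X -> X1) : pushforward mu phi `<< mu1 ->
  forall M, measurable M -> mu1 M = 0%E -> mu (phi @^-1` M) = 0%E.
Proof. by move=> /null_content_dominatesP h M mM M0; exact: h. Qed.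

Section preimage_marginal.
Context dX (X : measurableType dX) dY (Y : measurableType dY) (R : realType).
Context dX1 (X1 : measurableType dX1) dY1 (Y1 : measurableType dY1).
Variables (mu : {measure set X -> \bar R}) (nu : {measure set Y -> \bar R}).
Variables (mu1 : {measure set X1 -> \bar R}) (nu1 : {measure set Y1 -> \bar R}).
Variables (phi : X -> X1) (psi : Y -> Y1).
Hypotheses (mphi : measurable_fun [set: X] phi) (mpsi : measurable_fun [set: Y] psi).
Hypotheses (phi_ac : pushforward mu phi `<< mu1) (psi_ac : pushforward nu psi `<< nu1).

Let mpre1 A : measurable A -> measurable (phi @^-1` A).
Proof. by move=> mA; rewrite -[X in measurable X]setTI; exact: mphi. Qed.

Let mpre2 A : measurable A -> measurable (psi @^-1` A).
Proof. by move=> mA; rewrite -[X in measurable X]setTI; exact: mpsi. Qed.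

(** Absolute continuity of the image measures makes the preimages of the two null sets null. *)
Lemma marginally_null_preimage (E : set (X1 * Y1)) : marginally_null mu1 nu1 E ->
  marginally_null mu nu [set p | E (phi p.1, psi p.2)].
Proof.
move=> [M [N [[mM M0] [mN N0] EMN]]].
exists (phi @^-1` M), (psi @^-1` N); split.
- by split; [exact: mpre1|exact: pushforward_null phi_ac _ _ _].
- by split; [exact: mpre2|exact: pushforward_null psi_ac _ _ _].
- by move=> [x y] /= /EMN[[? _]|[_ ?]]; [left|right].
Qed.

Lemma omega_closed_preimage (kappa1 : set (X1 * Y1)) : omega_closed mu1 nu1 kappa1 ->
  omega_closed mu nu [set p : X * Y | kappa1 (phi p.1, psi p.2)].
Proof.
move=> [al [be [mal mbe h]]].
exists (fun n => phi @^-1` (al n)), (fun n => psi @^-1` (be n)); split.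
- by move=> n; exact: mpre1.
- by move=> n; exact: mpre2.
- apply: sub_marginally_null (marginally_null_preimage h) => -[x y] /=.
  by case=> -[h1 h2]; [left|right].
Qed.

End preimage_marginal.

Section square_summable_operations.
Context d (X : measurableType d) (R : realType) (mu : {measure set X -> \bar R}).

Lemma square_summable_mulchi (A : set X) f : measurable A ->
  square_summable mu f -> square_summable mu (fun k => mulchi A (f k)).
Proof.
move=> mA /square_summableP[L foo]; apply/square_summableP.
split; first by move=> k; exact: L2_mulchi.
rewrite (le_lt_trans _ foo) //; apply: ge0_le_integral => //.
- by move=> x _; exact: pointwise_sqsum_ge0.
- apply: measurable_pointwise_sqsum => k; apply: cmeasurable_mulchi => //.
  exact: L2_cmeasurable (L k).
- by apply: measurable_pointwise_sqsum => k; exact: L2_cmeasurable (L k).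
- move=> x _; apply: lee_nneseries => k _; rewrite lee_fin ?sqr_ge0 //.
  rewrite mulchiE; case: ifP => // _.
  by rewrite ComplexField.Normc.normc0 expr0n sqr_ge0.
Qed.

Lemma square_summable_single (f : X -> R[i]) : L2 mu f ->
  square_summable mu (fun k => if k is 0%N then f else fun=> 0).
Proof.
move=> hf; apply/square_summableP; split; first by case=> // k; exact: L2_0.
rewrite (_ : (\int[mu]_x _)%E = sqint mu f); first exact: L2_lty hf.
apply: eq_integral => x _; rewrite /pointwise_sqsum nneseries_recl //.
  rewrite eseries0 ?adde0 // => -[|k] //= _ _.
  by rewrite expr0n /= addr0 sqrtr0 expr0n.
by move=> k; rewrite lee_fin sqr_ge0.
Qed.

End square_summable_operations.

Section rectangles.
Context dX (X : measurableType dX) dY (Y : measurableType dY) (R : realType).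
Variables (mu : {measure set X -> \bar R}) (nu : {measure set Y -> \bar R}).

Variables (T : (X -> R[i]) -> (Y -> R[i])) (kappa : set (X * Y)).

(** Let the rectangle alpha x beta be marginally disjoint from kappa, and put v = P(beta) S P(alpha)
    f. The elementary tensor of P(alpha) f and conj v is supported in the rectangle, so it belongs
    to Phi(kappa); its pairing with S is the squared norm of v. It is presented as a series whose
    terms after the first are zero. *)
Lemma sub_Mmin_Mmax : Mmin mu nu kappa `<=` Mmax mu nu kappa.
Proof.
move=> S [bS hS]; split => // al be mal mbe hnull f hf.
have [SL2 _ _ _] := bS.
have hu := SL2 _ (L2_mulchi mal hf); set u := S (mulchi al f) in hu *.
have hbu : L2 nu (mulchi be u) by exact: L2_mulchi.
have hg := L2_conj hbu.
pose F k := if k is 0%N then mulchi al f else fun=> 0.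
pose G k := if k is 0%N then fun y => (mulchi be u y)^* else fun=> 0.
pose h (p : X * Y) := mulchi al f p.1 * (mulchi be u p.2)^*.
have sumE (V : nat -> R[i]) n : (forall k, V k.+1 = 0) ->
    \sum_(0 <= k < n.+1) V k = V 0%N.
  by move=> V0; rewrite big_nat_recl // big1 ?addr0 // => k _; rewrite V0.
have cst_cvg (V : nat -> R[i]) l : (forall k, V k.+1 = 0) -> V 0%N = l ->
    (\sum_(0 <= k < n) V k : R[i]^o) @[n --> \oo] --> (l : R[i]^o).
  move=> V0 Vl; apply/cvg_null_seq/null_seqP => e e0; exists 1%N => -[|n] // _.
  by rewrite sumE // Vl subrr ComplexField.Normc.normc0.
have exph : tensor_expansion mu nu h F G.
  split; [exact: square_summable_single (L2_mulchi mal hf)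
    |exact: square_summable_single hg|].
  exists set0, set0; split; rewrite ?measure0 //; move=> p /= []; apply: cst_cvg => //.
  by move=> k; rewrite mulr0.
have hphi : Phi mu nu kappa h.
  split; first by exists F, G.
  apply: sub_marginally_null hnull => p /= h0.
  have [kp|nk] := pselect (kappa p); last first.
    by case: h0; rewrite indicE memNset ?mulr0.
  split => //; split; apply: contrapT => nin; case: h0.
    by rewrite /h mulchiE memNset ?mul0r.
  by rewrite /h [mulchi be _ _]mulchiE memNset // conjC0 mulr0 mul0r.
have hz : cpairing nu u (fun y => (mulchi be u y)^*) = 0.
  apply: (hS h hphi); exists F, G; split => //; apply: cst_cvg => [k|]; last by rewrite L2inner_conj.
  rewrite L2inner_conj /= (cpairingC nu) -[fun=> 0](funext (fun y =>
    mul0r (0 : R[i]))).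
  by rewrite cpairingZl ?mul0r //; [exact: L2_0|exact: SL2 (L2_0 mu)].
apply: (cpairing_conj hbu); rewrite cpairing_mulchi -[RHS]hz; congr cpairing.
apply/funext => y; rewrite !mulchiE.
by case: ifP => [->|_] //; rewrite conjC0.
Qed.

Hypothesis hT : Mmax mu nu kappa T.
Hypotheses (smu : sigma_finite [set: X] mu) (snu : sigma_finite [set: Y] nu).
Variables (h : X * Y -> R[i]) (f : nat -> X -> R[i]) (g : nat -> Y -> R[i]).
Hypothesis hfg : tensor_expansion mu nu h f g.
Hypothesis hkappa : marginally_ae mu nu (fun p => h p * (\1_kappa p)%:C%C = 0).

(** The contribution of A x B to the pairing. Since convergence to 0 is part of the claim, blocks
    can be added up without a separate summability argument. *)
Definition null_block (A : set X) (B : set Y) := null_seq (fun n =>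
  \sum_(0 <= k < n) cpairing nu (T (mulchi A (f k))) (mulchi B (g k))).

Let hb : bounded_bilinear mu nu (fun u v => cpairing nu (T u) v).
Proof. by apply: bounded_operator_bilinear; case: hT. Qed.

Let Lf k : L2 mu (f k). Proof. by case: hfg => -[]. Qed.
Let Lg k : L2 nu (g k). Proof. by case: hfg => _ []. Qed.

Lemma null_block_disjoint (A : set X) (B : set Y) : measurable A -> measurable B ->
  marginally_null mu nu ((A `*` B) `&` kappa) -> null_block A B.
Proof.
move=> mA mB hnull; have [[TL2 _ _ _] hT0] := hT.
rewrite /null_block; under eq_fun => n.
  under eq_bigr => k _.
    rewrite -cpairing_mulchi (ae_eq_cpairing (u' := fun=> 0) _ _ (Lg k)).
    - rewrite (_ : (fun=> 0) = (fun y => 0 * (fun=> 0) y)); last first.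
        by apply/funext => y; rewrite mul0r.
      rewrite (cpairingZl 0 (L2_0 nu) (Lg k)) mul0r; over.
    - by apply: L2_mulchi => //; apply: TL2; exact: L2_mulchi.
    - exact: L2_0.
    - exact: hT0.
  rewrite big1_eq; over.
exact: null_seq0.
Qed.

(** The cut-down expansion converges to 0 marginally almost everywhere: on the rectangle because h
    vanishes on kappa, off it because every term is 0. Then [null_pairing] applies. *)
Lemma null_block_inside (A : set X) (B : set Y) : measurable A -> measurable B ->
  marginally_null mu nu ((A `*` B) `\` kappa) -> null_block A B.
Proof.
move=> mA mB hnull; have [sf sg hcv] := hfg.
apply: (null_pairing smu snu hb).
- exact: square_summable_mulchi.
- exact: square_summable_mulchi.
have hn : marginally_ae mu nu (fun p => (A `*` B) p -> kappa p).
  apply: sub_marginally_null hnull => p /= hp; apply: contrapT => hn.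
  by apply: hp => ABp; apply: contrapT => nk; apply: hn.
apply: marginally_aeI hcv (marginally_aeI hkappa hn (fun p h1 h2 => conj h1 h2)) _.
move=> p /cvg_null_seq cv [hk ABk].
have [ABp|nAB] := pselect ((A `*` B) p).
  have hp0 : h p = 0.
    by move: hk; rewrite indicE mem_set ?mulr1 //; exact: ABk.
  case: ABp => Ap Bp; move: cv; congr (null_seq _); apply/funext => n.
  rewrite hp0 subr0; apply: eq_bigr => k _.
  by rewrite !mulchiE !mem_set.
rewrite (_ : (fun _ => _) = fun=> 0); first exact: null_seq0.
apply/funext => n; rewrite big1 // => k _; rewrite !mulchiE.
case: ifPn => [/set_mem Ap|_]; rewrite ?mul0r //.
by case: ifPn => [/set_mem Bp|_]; rewrite ?mulr0 //; case: nAB.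
Qed.

Lemma null_blockUl A A' B : measurable A -> measurable A' -> measurable B ->
  [disjoint A & A'] -> null_block A B -> null_block A' B -> null_block (A `|` A') B.
Proof.
move=> mA mA' mB dA h1 h2; have := null_seqD h1 h2; congr (null_seq _).
apply/funext => n; rewrite -big_split; apply: eq_bigr => k _ /=.
case: hb => bl _ _; rewrite mulchiU // -[in LHS](mul1r (cpairing nu (T (mulchi A (f k))) _)).
rewrite -bl; [|exact: L2_mulchi..].
by congr (cpairing nu (T _) _); apply/funext => x; rewrite mul1r.
Qed.

Lemma null_blockUr A B B' : measurable A -> measurable B -> measurable B' ->
  [disjoint B & B'] -> null_block A B -> null_block A B' -> null_block A (B `|` B').
Proof.
move=> mA mB mB' dB h1 h2; have := null_seqD h1 h2; congr (null_seq _).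
apply/funext => n; rewrite -big_split; apply: eq_bigr => k _ /=.
case: hb => _ br _; rewrite mulchiU // -[in LHS](mul1r (cpairing nu _ (mulchi B (g k)))).
rewrite -br; [|exact: L2_mulchi..].
by congr (cpairing nu _ _); apply/funext => x; rewrite mul1r.
Qed.

(** Writing f_k and g_k as sums of their restrictions turns each partial sum into a sum over
    finitely many blocks, and a finite sum of null sequences is null. *)
Lemma null_block_bigsetU (N M : nat) (A : 'I_N -> set X) (B : 'I_M -> set Y) :
  (forall i, measurable (A i)) -> (forall j, measurable (B j)) ->
  trivIset [set: 'I_N] A -> trivIset [set: 'I_M] B ->
  \bigcup_i A i = [set: X] -> \bigcup_j B j = [set: Y] ->
  (forall i j, null_block (A i) (B j)) ->
  null_seq (fun n => \sum_(0 <= k < n) cpairing nu (T (f k)) (g k)).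
Proof.
move=> mA mB tA tB cA cB hAB.
have decomp d (Z : measurableType d) K (C : 'I_K -> set Z) (w : Z -> R[i]) :
    trivIset [set: 'I_K] C -> \bigcup_i C i = [set: Z] ->
    w = fun z => \sum_(i < K) 1 * mulchi (C i) w z.
  move=> tC cC; apply/funext => z; have [i _ Ciz] : (\bigcup_i C i) z by rewrite cC.
  rewrite (bigD1 i) //= big1 => [|j ji]; rewrite mul1r mulchiE.
    by rewrite mem_set // addr0.
  rewrite memNset // => Cjz; move/trivIsetP : tC => /(_ j i Logic.I Logic.I ji) tr.
  by have : (C j `&` C i) z by []; rewrite tr.
have := null_seq_sum (index_enum 'I_N) (fun i => null_seq_sum (index_enum 'I_M) (hAB i)).
congr (null_seq _); apply/funext => n.
under eq_bigr do rewrite exchange_big /=.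
rewrite exchange_big /=; apply: eq_bigr => k _.
rewrite [in RHS](decomp _ _ _ A (f k)) // (bilinear_suml hb) //; last first.
  by move=> i; exact: L2_mulchi.
apply: eq_bigr => i _; rewrite mul1r [in RHS](decomp _ _ _ B (g k)) //.
rewrite (bilinear_sumr hb); [|exact: L2_mulchi|by move=> j; exact: L2_mulchi].
by apply: eq_bigr => j _; rewrite mul1r.
Qed.

End rectangles.

(** * Blocks on which one of the maps is constant *)

Section constant_blocks.
Context dX (X : measurableType dX) dY (Y : measurableType dY) (R : realType).
Context dX1 (X1 : measurableType dX1) dY1 (Y1 : measurableType dY1).
Variables (mu : {measure set X -> \bar R}) (nu : {measure set Y -> \bar R}).
Variables (mu1 : {measure set X1 -> \bar R}) (nu1 : {measure set Y1 -> \bar R}).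
Variables (phi : X -> X1) (psi : Y -> Y1).
Hypotheses (mphi : measurable_fun [set: X] phi) (mpsi : measurable_fun [set: Y] psi).
Hypotheses (phi_ac : pushforward mu phi `<< mu1) (psi_ac : pushforward nu psi `<< nu1).
Hypotheses (smu : sigma_finite [set: X] mu) (snu : sigma_finite [set: Y] nu).
Variable kappa1 : set (X1 * Y1).
Hypothesis kappa1_closed : omega_closed mu1 nu1 kappa1.
Let kappa := [set p : X * Y | kappa1 (phi p.1, psi p.2)].
Variable T : (X -> R[i]) -> (Y -> R[i]).
Hypothesis hT : Mmax mu nu kappa T.
Variables (h : X * Y -> R[i]) (f : nat -> X -> R[i]) (g : nat -> Y -> R[i]).
Hypothesis hfg : tensor_expansion mu nu h f g.
Hypothesis hkappa : marginally_ae mu nu (fun p => h p * (\1_kappa p)%:C%C = 0).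

(* A rectangle with [phi] constantly [c] on its first side splits, along the slice
   of [kappa1] at [c], into one rectangle disjoint from [kappa] and one inside it.
   The slice is only controlled when [c] avoids the exceptional null set [M]; absolute
   continuity makes the rectangle null otherwise. *)
Lemma null_block_constl (A : set X) (B : set Y) : measurable A -> measurable B ->
  ae_constant_on mu A phi -> null_block nu T f g A B.
Proof.
move=> mA mB [c [M0 [mM0 M00 hc]]].
have Ac x : A x -> ~ M0 x -> phi x = c.
  by move=> Ax nx; apply: contrapT => h'; apply: nx; apply: hc => /= /(_ Ax).
have [al [be [mal mbe [M [N [[mM MZ] [mN NZ] hMN]]]]]] := kappa1_closed.
have mpre D : measurable D -> measurable (psi @^-1` D).
  by move=> mD; rewrite -[X in measurable X]setTI; exact: mpsi.
have mpre1 D : measurable D -> measurable (phi @^-1` D).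
  by move=> mD; rewrite -[X in measurable X]setTI; exact: mphi.
have mu_pre := pushforward_null phi_ac mM MZ.
have nu_pre := pushforward_null psi_ac mN NZ.
have [cM|cM] := pselect (M c).
  apply: (null_block_disjoint hT hfg) => //.
  exists (M0 `|` phi @^-1` M), set0; split; rewrite ?measure0 //.
    by split; [apply: measurableU => //; exact: mpre1|rewrite measureU0 //; exact: mpre1].
  move=> [x y] [[/= Ax _] _]; left; split => //=.
  by have [?|nx] := pselect (M0 x); [left|right; rewrite /preimage /= (Ac x)].
(* The set of y with (c, psi y) outside kappa1 need not be measurable. [E] is built from the
   rectangles instead and agrees with it off the preimage of [N], because c avoids [M]. *)
pose E := psi @^-1` (\bigcup_(n in [set n | al n c]) be n).
have mE : measurable E by apply: mpre; apply: bigcup_measurable.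
have slice y : ~ N (psi y) -> (E y <-> ~ kappa1 (c, psi y)).
  move=> nN; have sub : (~` kappa1 `+` \bigcup_n (al n `*` be n)) (c, psi y) -> False.
    by move=> /hMN[[]|[]].
  split => [[n /= an bn] k|nk].
    by apply: sub; right; split; [exists n|exact].
  apply: contrapT => nE; apply: sub; left; split => // -[n _ [an bn]].
  by apply: nE; exists n.
have -> : B = (B `&` E) `|` (B `\` E) by rewrite setUIDK.
have mBE : measurable (B `&` E) by exact: measurableI.
have mBD : measurable (B `\` E) by exact: measurableD.
have exc (P : set (X * Y)) : (forall x y, A x -> phi x = c -> ~ N (psi y) -> ~ P (x, y)) ->
    P `<=` A `*` [set: Y] -> marginally_null mu nu P.
  move=> hP PA; exists M0, (psi @^-1` N); split => //; first by split => //; exact: mpre.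
  move=> [x y] Pxy; have [/= Ax _] := PA _ Pxy.
  have [?|nx] := pselect (M0 x); first by left.
  have [?|nN] := pselect (N (psi y)); first by right.
  by case: (hP x y Ax (Ac x Ax nx) nN).
apply: (null_blockUr hT hfg) => //.
- by apply/disj_setPS => y [[_ ?] []].
- apply: (null_block_disjoint hT hfg) => //; apply: exc; last by move=> [x y] [[]].
  by move=> x y Ax xc nN [[_ [_ /= /(slice y nN) nk]]]; rewrite /kappa /= xc.
- apply: (null_block_inside hT smu snu hfg hkappa) => //; apply: exc; last by move=> [x y] [[]].
  move=> x y Ax xc nN [[_ [_ /= nE]]]; rewrite /kappa /= xc => nk.
  by apply: nE; apply/(slice y nN).
Qed.

(** The mirror image of [null_block_constl]: [kappa1] is sliced at a fixed second coordinate and the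
    first side is split. *)
Lemma null_block_constr (A : set X) (B : set Y) : measurable A -> measurable B ->
  ae_constant_on nu B psi -> null_block nu T f g A B.
Proof.
move=> mA mB [c [N0 [mN0 N00 hc]]].
have Bc y : B y -> ~ N0 y -> psi y = c.
  by move=> By ny; apply: contrapT => h'; apply: ny; apply: hc => /= /(_ By).
have [al [be [mal mbe [M [N [[mM MZ] [mN NZ] hMN]]]]]] := kappa1_closed.
have mpre D : measurable D -> measurable (psi @^-1` D).
  by move=> mD; rewrite -[X in measurable X]setTI; exact: mpsi.
have mpre1 D : measurable D -> measurable (phi @^-1` D).
  by move=> mD; rewrite -[X in measurable X]setTI; exact: mphi.
have mu_pre := pushforward_null phi_ac mM MZ.
have nu_pre := pushforward_null psi_ac mN NZ.
have [cN|cN] := pselect (N c).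
  apply: (null_block_disjoint hT hfg) => //.
  exists set0, (N0 `|` psi @^-1` N); split; rewrite ?measure0 //.
    by split; [apply: measurableU => //; exact: mpre|rewrite measureU0 //; exact: mpre].
  move=> [x y] [[/= _ By] _]; right; split => //=.
  by have [?|ny] := pselect (N0 y); [left|right; rewrite /preimage /= (Bc y)].
pose E := phi @^-1` (\bigcup_(n in [set n | be n c]) al n).
have mE : measurable E by apply: mpre1; apply: bigcup_measurable.
have slice x : ~ M (phi x) -> (E x <-> ~ kappa1 (phi x, c)).
  move=> nM; have sub : (~` kappa1 `+` \bigcup_n (al n `*` be n)) (phi x, c) -> False.
    by move=> /hMN[[]|[]].
  split => [[n /= bn an] k|nk].
    by apply: sub; right; split; [exists n|exact].
  apply: contrapT => nE; apply: sub; left; split => // -[n _ [an bn]].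
  by apply: nE; exists n.
have -> : A = (A `&` E) `|` (A `\` E) by rewrite setUIDK.
have mAE : measurable (A `&` E) by exact: measurableI.
have mAD : measurable (A `\` E) by exact: measurableD.
have exc (P : set (X * Y)) : (forall x y, B y -> psi y = c -> ~ M (phi x) -> ~ P (x, y)) ->
    P `<=` [set: X] `*` B -> marginally_null mu nu P.
  move=> hP PB; exists (phi @^-1` M), N0; split => //; first by split => //; exact: mpre1.
  move=> [x y] Pxy; have [/= _ By] := PB _ Pxy.
  have [?|ny] := pselect (N0 y); first by right.
  have [?|nM] := pselect (M (phi x)); first by left.
  by case: (hP x y By (Bc y By ny) nM).
apply: (null_blockUl hT hfg) => //.
- by apply/disj_setPS => x [[_ ?] []].
- apply: (null_block_disjoint hT hfg) => //; apply: exc; last by move=> [x y] [[]].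
  by move=> x y By yc nM [[[_ /= /(slice x nM) nk] _]]; rewrite /kappa /= yc.
- apply: (null_block_inside hT smu snu hfg hkappa) => //; apply: exc; last by move=> [x y] [[]].
  move=> x y By yc nM [[[_ /= nE] _]]; rewrite /kappa /= yc => nk.
  by apply: nE; apply/(slice x nM).
Qed.

End constant_blocks.

(** * Charts *)

Section metric_base.
Context {R : realType} (T : metricType R).

Lemma metric_ball_open (x : T) (r : R) : open (ball x r).
Proof.
rewrite openE => y xy; rewrite /interior; move: xy; rewrite ballEmdist /= => xy.
apply/nbhs_ballP; exists (r - mdist x y); first by rewrite /= subr_gt0.
move=> z; rewrite !ballEmdist /= => yz.
by rewrite (le_lt_trans (metric_triangle x y z)) // -ltrBrDl.
Qed.

(** The sets are the balls of radius 1/(m+1) about the points of [D]. The index n names its centre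
    through an injection of [D] into nat, and the set is empty if n names no point. *)
Lemma metric_countable_base (D : set T) : countable D -> dense D ->
  exists W : nat -> nat -> set T, (forall n m, open (W n m)) /\
    forall U y, open U -> U y -> exists n m, W n m y /\ W n m `<=` U.
Proof.
move=> /countable_injP[i inji] dD.
exists (fun n m => [set y | exists d, [/\ D d, i d = n & ball d m.+1%:R^-1 y]]); split.
  move=> n m; rewrite openE => y [d [Dd dn dy]].
  have := metric_ball_open d m.+1%:R^-1; rewrite openE => /(_ y dy).
  by apply: filterS => z dz; exists d.
move=> U y oU Uy.
have [e /= e0 eU] : exists2 e : R, 0 < e & ball y e `<=` U.
  by apply/nbhs_ballP; exact: open_nbhs_nbhs.
have [m hm] : exists m, m.+1%:R^-1 < e / 2.
  have [m _ hm] := @near_infty_natSinv_lt R (PosNum (divr_gt0 e0 (ltr0n _ 2))).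
  by exists m; exact: hm (leqnn m).
have m0 : 0 < m.+1%:R^-1 :> R by rewrite invr_gt0 ltr0n.
have [d [yd Dd]] : (ball y m.+1%:R^-1 `&` D) !=set0.
  by apply: dD; [exists y; exact: ballxx|exact: metric_ball_open].
exists (i d), m; split; first by exists d; split => //; exact: ball_sym.
move=> z [d' [Dd' dd' d'z]]; apply: eU.
have edd : d' = d by apply: inji; rewrite ?inE.
rewrite edd in d'z; apply: (@ball_splitr _ _ d); apply: (le_ball (ltW hm)) => //.
exact: ball_sym.
Qed.

End metric_base.

(** * Large compact sets on which the map is continuous *)

Section lusin.
Context {R : realType} (X X1 : pointedCompleteMetricType R).
Variable mu : {measure set (borel X) -> \bar R}.
Hypothesis hmu : standard_measure mu.

Lemma borel_open (T : pointedCompleteMetricType R) (U : set T) : open U ->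
  measurable (U : set (borel T)).
Proof. exact: sub_sigma_algebra. Qed.

Lemma borel_closed (T : pointedCompleteMetricType R) (C : set T) : closed C ->
  measurable (C : set (borel T)).
Proof.
by move=> cC; rewrite -[C]setCK; apply: measurableC; apply: borel_open; exact: closed_openC.
Qed.

Lemma borel_compact (T : pointedCompleteMetricType R) (K : set T) : compact K ->
  measurable (K : set (borel T)).
Proof.
by move=> cK; apply: borel_closed; apply: compact_closed => //; exact: metric_hausdorff.
Qed.

Lemma compact_approx (B : set (borel X)) (e : R) : measurable B -> (mu B < +oo)%E ->
  0 < e -> exists K : set X, [/\ compact K, K `<=` B & (mu (B `\` K) < e%:E)%E].
Proof.
move=> mB Boo e0; have [_ _ reg _] := hmu; have [_ supB] := reg B mB.
have Bfin : mu B \is a fin_num by rewrite ge0_fin_numE.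
have : (mu B - e%:E < mu B)%E by rewrite lteBlDr // lteDl // lte_fin.
rewrite [X in (_ < X)%E]supB => hlt.
have [_ [K [cK KB] <-] hK] := ereal_sup_gt hlt; exists K; split => //.
have mK := borel_compact cK.
have Kfin : mu K \is a fin_num.
  by rewrite ge0_fin_numE // (le_lt_trans _ Boo) // le_measure ?inE.
rewrite measureD //.
rewrite setIidr //; rewrite lteBlDr // in hK.
by rewrite lteBlDr // addeC.
Qed.

Variable phi : borel X -> borel X1.
Hypothesis mphi : measurable_fun [set: borel X] phi.
Hypothesis sepX1 : exists2 D : set X1, countable D & dense D.

(** For each basic open [W k], the parts of [B] inside and outside its preimage [P k] contain
    compact sets [K k] and [L k] that nearly fill them. On the intersection of all the unions of
    [K k] and [L k], the preimage of [W k] is the complement of the closed set [L k], hence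
    relatively open, and [phi] is continuous there. *)
Lemma lusin_compact (B : set (borel X)) (e : R) : measurable B -> (mu B < +oo)%E ->
  0 < e -> exists K : set X, [/\ compact K, K `<=` B, (mu (B `\` K) <= e%:E)%E &
    {within K, continuous (phi : X -> X1)}].
Proof.
move=> mB Boo e0; have [D1 cD1 dD1] := sepX1.
have [W0 [oW0 hW0]] := metric_countable_base cD1 dD1.
pose W k := let: (n, m) := odflt (0%N, 0%N) (unpickle k) in W0 n m.
have oW k : open (W k) by rewrite /W; case: (odflt _ _) => n m.
have hW U y : open U -> U y -> exists2 k, W k y & W k `<=` U.
  move=> oU Uy; have [n [m [Wy WU]]] := hW0 U y oU Uy.
  by exists (pickle (n, m)); rewrite /W pickleK.
pose P k : set (borel X) := phi @^-1` (W k).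
have mP k : measurable (P k).
  by rewrite -[X in measurable X]setTI; apply: mphi => //; exact: borel_open.
(* Two sets are approximated for each k, so each gets half of the k-th term of a series with sum
   e. *)
pose r k : R := e / (2 ^ k.+1)%:R / 2.
have r0 k : 0 < r k by rewrite !divr_gt0 // ltr0n expn_gt0.
have sub_fin C : measurable C -> C `<=` B -> (mu C < +oo)%E.
  by move=> mC CB; rewrite (le_lt_trans _ Boo) // le_measure ?inE.
have exK k : exists K : set X, [/\ compact K, K `<=` B `&` P k &
    (mu ((B `&` P k) `\` K) < (r k)%:E)%E].
  have mBP : measurable (B `&` P k) by exact: measurableI.
  by apply: compact_approx => //; apply: sub_fin.
have exL k : exists K : set X, [/\ compact K, K `<=` B `\` P k &
    (mu ((B `\` P k) `\` K) < (r k)%:E)%E].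
  have mBP : measurable (B `\` P k) by exact: measurableD.
  by apply: compact_approx => //; apply: sub_fin.
have [K hK] := choice exK; have [L hL] := choice exL.
have cC k : compact (K k `|` L k).
  by have [? _ _] := hK k; have [? _ _] := hL k; exact: compactU.
have clC k : closed (K k `|` L k) by apply: compact_closed => //; exact: metric_hausdorff.
exists (\bigcap_k (K k `|` L k)); split.
- apply: (@subclosed_compact _ _ (K 0%N `|` L 0%N)) => //.
    by apply: closed_bigI => k _.
  exact: bigcap_inf.
- by move=> x /(_ 0%N Logic.I) [Kx|Lx];
    [have [_ h _] := hK 0%N; case: (h _ Kx)|have [_ h _] := hL 0%N; case: (h _ Lx)].
- have mC k : measurable (K k `|` L k : set (borel X)) by exact: borel_compact.
  have mBC : measurable (B `\` \bigcap_k (K k `|` L k) : set (borel X)).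
    by apply: measurableD => //; exact: bigcap_measurable.
  rewrite (le_trans (measure_sigma_subadditive mu (F := fun k => B `\` (K k `|` L k))
    (fun k => measurableD mB (mC k)) mBC _)) //.
    move=> x [Bx nx]; apply: contrapT => h; apply: nx => k _; apply: contrapT => nk.
    by apply: h; exists k.
  apply: le_trans (epsilon_trick0 xpredT (ltW e0)); apply: lee_nneseries => // k _.
  have [ck KB muK] := hK k; have [cl LB muL] := hL k.
  have mKk : measurable (K k : set (borel X)) by exact: borel_compact.
  have mLk : measurable (L k : set (borel X)) by exact: borel_compact.
  have mE1 : measurable ((B `&` P k) `\` K k) by apply: measurableD => //; exact: measurableI.
  have mE2 : measurable ((B `\` P k) `\` L k) by apply: measurableD => //; exact: measurableD.
  rewrite (@le_trans _ _ (mu (((B `&` P k) `\` K k) `|` ((B `\` P k) `\` L k)))) //.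
    apply: le_measure; rewrite ?inE //; [exact: measurableD|exact: measurableU|].
    move=> x [Bx /not_orP[nK nL]].
    by have [Px|nP] := pselect (P k x); [left|right].
  rewrite (le_trans (measureU2 mu mE1 mE2)) // (le_trans (leeD (ltW muK) (ltW muL))) //.
  by rewrite -EFinD lee_fin /r -splitr.
- apply/subspace_continuousP => x Kx U /= nU.
  have [V [oV Vx VU]] : exists V, [/\ open V, V (phi x) & V `<=` U].
    by move: nU; rewrite nbhsE => -[V [oV Vx] VU]; exists V.
  have [k Wk WV] := hW V _ oV Vx.
  have [cl LB _] := hL k; have [_ KB _] := hK k.
  have nLx : ~ L k x by move=> /LB[_ nP]; exact: nP.
  have oL : open (~` L k).
    by apply: closed_openC; apply: compact_closed => //; exact: metric_hausdorff.
  rewrite /within /=; near_simpl.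
  apply: filterS (open_nbhs_nbhs (conj oL nLx)) => z nLz Kz.
  case: (Kz k Logic.I) => // /KB[_ Pz]; apply: VU; exact: WV.
Qed.

End lusin.

(* [phi] maps [A] bijectively onto [D] with measurable inverse [theta], and carries
   [mu] on [A] to a measure on [D] whose density [rho] with respect to [mu1] is
   bounded above and away from zero. *)
Record chart {d d' : measure_display} {X : measurableType d} {X1 : measurableType d'}
  {R : realType} (mu : {measure set X -> \bar R}) (mu1 : {measure set X1 -> \bar R})
  (phi : X -> X1) (A : set X) (D : set X1) (theta : X1 -> X) (rho : X1 -> R) (c : R)
  : Prop := Chart {
  chart_dom : measurable A;
  chart_cod : measurable D;
  chart_fun : measurable_fun [set: X] phi;
  chart_inv : measurable_fun [set: X1] theta;
  chart_density : measurable_fun [set: X1] rho;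
  chart_funK : forall x, A x -> D (phi x) /\ theta (phi x) = x;
  chart_invK : forall y, D y -> A (theta y) /\ phi (theta y) = y;
  chart_gt0 : 0 < c;
  chart_bound : forall y, D y -> c^-1 <= rho y <= c;
  chart_integral : forall q : X1 -> \bar R, measurable_fun [set: X1] q ->
    (forall y, 0 <= q y)%E ->
    (\int[mu]_(x in A) q (phi x) = \int[mu1]_(y in D) (q y * (rho y)%:E))%E
}.

Section measure_copies.
Context d (X : measurableType d) (R : realType) (mu : {measure set X -> \bar R}).

(** This copy and the next are the measure itself, indexed by a proof of finiteness or
    sigma-finiteness, so that the structures required by the Radon-Nikodym theorem can be attached
    to it. *)
Definition finite_copy (_ : fin_num_fun mu) : set X -> \bar R := mu.

Definition sigma_finite_copy (_ : sigma_finite [set: X] mu) : set X -> \bar R := mu.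

HB.instance Definition _ h := Measure.copy (finite_copy h) mu.
HB.instance Definition _ h := Measure_isFinite.Build _ _ _ (finite_copy h) h.
HB.instance Definition _ h := Measure.copy (sigma_finite_copy h) mu.
HB.instance Definition _ h := Measure_isSigmaFinite.Build _ _ _ (sigma_finite_copy h) h.

End measure_copies.

(** * The density of the image measure *)

Section pushed_density.
Context d d' (X : measurableType d) (X1 : measurableType d') (R : realType).
Variables (mu : {measure set X -> \bar R}) (mu1 : {measure set X1 -> \bar R}).
Variable phi : X -> X1.
Hypothesis mphi : measurable_fun [set: X] phi.
Hypothesis phi_ac : pushforward mu phi `<< mu1.
Hypothesis smu1 : sigma_finite [set: X1] mu1.

(** The image of a sigma-finite measure need not be sigma-finite. Restricting to a set [K] of finite
    measure first gives a finite image measure, still absolutely continuous; its Radon-Nikodym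
    derivative is [r], and the formula is the change of variables. *)
Lemma pushed_density (K : set X) : measurable K -> (mu K < +oo)%E ->
  exists r : X1 -> R, [/\ measurable_fun [set: X1] r, forall y, 0 <= r y &
   forall (q : X1 -> \bar R) E, measurable E -> measurable_fun [set: X1] q ->
    (forall y, 0 <= q y)%E ->
    (\int[mu]_(x in K `&` phi @^-1` E) q (phi x) =
     \int[mu1]_(y in E) (q y * (r y)%:E))%E].
Proof.
move=> mK Koo.
have mpre E : measurable E -> measurable (phi @^-1` E).
  by move=> mE; rewrite -[X in measurable X]setTI; exact: mphi.
pose lam : {measure set X -> \bar R} := mrestr mu mK.
pose nu0 := pushforward lam phi.
have [nu nuE] : exists nu : {measure set X1 -> \bar R}, nu = nu0 :> (set X1 -> \bar R).
  by unshelve eexists (pushforward lam phi : {measure set X1 -> \bar R}).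
have nu_fin : fin_num_fun nu.
  move=> E mE; rewrite nuE /nu0 /pushforward /lam /= /mrestr ge0_fin_numE //.
  have mEK : measurable (phi @^-1` E `&` K) by apply: measurableI => //; exact: mpre.
  by rewrite (le_lt_trans _ Koo) // le_measure ?inE.
pose nuf := finite_copy nu_fin.
pose mus := sigma_finite_copy smu1.
have dom : (nuf : {finite_measure set X1 -> \bar R}) `<<
    (mus : {sigma_finite_measure set X1 -> \bar R}).
  apply/null_content_dominatesP => E mE E0.
  have mEK : measurable (phi @^-1` E `&` K) by apply: measurableI => //; exact: mpre.
  change (nu E = 0%E); rewrite nuE /nu0 /pushforward /lam /= /mrestr.
  apply/eqP; rewrite eq_le measure_ge0 andbT -(pushforward_null phi_ac mE E0).
  by rewrite le_measure ?inE //; exact: mpre.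
pose g := Radon_Nikodym_SigmaFinite.f nuf mus.
have g0 := Radon_Nikodym_SigmaFinite.f_ge0 dom.
have gfin := Radon_Nikodym_SigmaFinite.f_fin_num dom.
have gint := Radon_Nikodym_SigmaFinite.f_integrable dom.
exists (fine \o g); split.
- by apply: measurableT_comp => //; exact: measurable_int gint.
- by move=> y; apply: fine_ge0; exact: g0.
move=> q E mE mq q0.
have h1 := @Radon_Nikodym_SigmaFinite.change_of_variables _ _ _ nuf mus dom q E q0 mE
  (measurable_funTS mq).
transitivity (\int[mus]_(y in E) (q y * g y))%E; last first.
  by apply: eq_integral => y _; rewrite fineK //; exact: gfin.
rewrite [RHS]h1.
have -> : (\int[nuf]_(y in E) q y = \int[pushforward lam phi]_(y in E) q y)%E.
  by change (\int[nu]_(y in E) q y = \int[pushforward lam phi]_(y in E) q y)%E; rewrite nuE.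
have mE' := mpre E mE.
have mqphi : measurable_fun [set: X] (q \o phi) by exact: measurableT_comp.
rewrite ge0_integral_pushforward //; last exact: measurable_funTS.
have splitE : phi @^-1` E = (K `&` phi @^-1` E) `|` (phi @^-1` E `\` K).
  by rewrite setIC setUIDK.
rewrite [in RHS]splitE.
have m1 : measurable (K `&` phi @^-1` E) by exact: measurableI.
have m2 : measurable (phi @^-1` E `\` K) by exact: measurableD.
rewrite ge0_integral_setU //; last 3 first.
- exact: measurable_funTS.
- by move=> x _; exact: q0.
- by apply/disj_setPS => x [[]] ? _ [].
rewrite [X in (_ + X)%E]null_set_integral ?adde0 //; last 2 first.
- exact: measurable_funTS.
- by rewrite /lam /= /mrestr setDE -setIA setICl setI0 measure0.
apply: (@eq_measure_integral _ _ _ _ lam mu) => C mC CK.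
by rewrite /lam /= /mrestr setIidl // => x /CK[].
Qed.

End pushed_density.

(** * Existence of charts *)

Section chart_existence.
Context {R : realType} (X X1 : pointedCompleteMetricType R).
Variables (mu : {measure set (borel X) -> \bar R}).
Variables (mu1 : {measure set (borel X1) -> \bar R}).
Variable phi : borel X -> borel X1.
Hypothesis mphi : measurable_fun [set: borel X] phi.

Definition inverse_on (K : set X) (y : X1) : X := xget point [set x | K x /\ phi x = y].

Lemma inverse_onP (K : set X) x : K x -> K (inverse_on K (phi x)) /\
  phi (inverse_on K (phi x)) = phi x.
Proof. by move=> Kx; apply: (@xgetPex _ point [set z | K z /\ phi z = phi x]); exists x. Qed.

(** Continuity sends a closed subset of [K] to a compact, hence Borel, set. The preimage of a closed
    F under the inverse is the image of the part of [K] in F, together with the complement of the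
    image of [K] when F contains the default value [point]. *)
Lemma measurable_inverse_on (K : set X) : compact K ->
  {within K, continuous (phi : X -> X1)} -> {in K &, injective phi} ->
  measurable_fun [set: borel X1] (inverse_on K : borel X1 -> borel X).
Proof.
move=> cK phiK inj.
have mim F : closed F -> measurable (phi @` (K `&` F) : set (borel X1)).
  move=> cF; apply: borel_compact; apply: (@continuous_compact X X1).
    exact: (continuous_subspaceW _ phiK).
  apply: (subclosed_compact _ cK); last exact: subIsetl.
  by apply: closedI => //; apply: compact_closed => //; exact: metric_hausdorff.
have mF F : closed F -> measurable (inverse_on K @^-1` F : set (borel X1)).
  move=> cF.
  have -> : inverse_on K @^-1` F = phi @` (K `&` F) `|`
      (if pselect (F point) then ~` (phi @` (K `&` setT)) else set0).
    apply/seteqP; split => y /=.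
      move=> Fy; have [[x Kx xy]|ny] := pselect (exists2 x, K x & phi x = y).
        left; exists (inverse_on K y); last by rewrite -xy; have [] := inverse_onP Kx.
        by split => //; rewrite -xy; have [] := inverse_onP Kx.
      have ptE : inverse_on K y = point.
        by apply: xgetPN => x [Kx xy]; apply: ny; exists x.
      right; rewrite ptE in Fy; case: pselect => // _ [x [Kx _] xy].
      by apply: ny; exists x.
    move=> [[x [Kx Fx] <-]|].
      have [K' e] := inverse_onP Kx.
      by rewrite /preimage /= (inj _ _ _ _ e) ?inE.
    case: pselect => // Fpt ny; rewrite /preimage /=.
    suff -> : inverse_on K y = point by [].
    by apply: xgetPN => x [Kx xy]; apply: ny; exists x.
  apply: (measurableU (phi @` (K `&` F) : set (borel X1))); first exact: mim.
  case: pselect => ? /=; last exact: measurable0.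
  by apply: measurableC; apply: mim; exact: closedT.
apply: (@measurability _ _ (borel X1) (borel X) setT (inverse_on K)
  (@open X)) => // _ [U oU <-]; rewrite setTI.
rewrite -[U]setCK preimage_setC; apply: measurableC; exact: (mF (~` U) (open_closedC oU)).
Qed.

Lemma compact_chart (K : set X) (r : borel X1 -> R) (c : R) :
  compact K -> {within K, continuous (phi : X -> X1)} -> {in K &, injective phi} ->
  measurable_fun [set: borel X1] r -> 0 < c ->
  (forall (q : borel X1 -> \bar R) E, measurable E -> measurable_fun [set: borel X1] q ->
    (forall y, 0 <= q y)%E ->
    (\int[mu]_(x in K `&` phi @^-1` E) q (phi x) =
     \int[mu1]_(y in E) (q y * (r y)%:E))%E) ->
  chart mu mu1 phi (K `&` phi @^-1` [set y | c^-1 <= r y <= c])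
    (phi @` K `&` [set y | c^-1 <= r y <= c]) (inverse_on K) r c.
Proof.
move=> cK phiK inj mr c0 hr; set S := [set y | _].
have mS : measurable (S : set (borel X1)).
  have -> : S = [set: borel X1] `&` r @^-1` `[c^-1, c].
    by rewrite setTI; apply/seteqP; split => y; rewrite /S /preimage /= in_itv.
  by apply: mr.
have mK : measurable (K : set (borel X)) by exact: borel_compact.
have mpK : measurable (phi @` K : set (borel X1)).
  by apply: borel_compact; exact: (@continuous_compact X X1).
have mpS : measurable (phi @^-1` S) by rewrite -[X in measurable X]setTI; exact: mphi.
have funK x : K x -> inverse_on K (phi x) = x.
  by move=> Kx; have [K' e] := inverse_onP Kx; apply: inj; rewrite ?inE.
split => //.
- exact: measurableI.
- exact: measurableI.
- exact: measurable_inverse_on.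
- by move=> x [Kx Sx]; split; [split => //; exists x|exact: funK].
- by move=> y [[x Kx <-] Sx]; rewrite funK.
- by move=> y [].
- move=> q mq q0; rewrite -hr //; last exact: measurableI.
  congr (\int[mu]_(x in _) _)%E; apply/seteqP; split => x.
    by move=> [Kx Sx]; split => //; split => //; exists x.
  by move=> [Kx [_ Sx]].
Qed.

Hypothesis hmu : standard_measure mu.
Hypothesis hmu1 : standard_measure mu1.
Hypothesis phi_ac : pushforward mu phi `<< mu1.

(** Three losses of e/3 each: the complement of a set [Z] of finite measure, the part of [X0] in [Z]
    missed by a compact [K] from Lusin's theorem, and the part of [K] where the density leaves the
    interval from 1/(n+1) to n+1. *)
Lemma chart_exhaustion (X0 : set (borel X)) f (e : R) : measurable X0 ->
  set_inj X0 phi -> square_summable mu f -> 0 < e ->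
  exists A D theta rho c, [/\ chart mu mu1 phi A D theta rho c, A `<=` X0 &
    forall N, \sum_(0 <= k < N) sqnorm mu (mulchi (X0 `\` A) (f k)) <= e].
Proof.
move=> mX0 inj0 sf e0.
have [_ _ _ smu] := hmu; have [_ sep1 _ smu1] := hmu1.
have e3 : 0 < e / 3 by lra.
have [Z0 [Z0T ndZ mZ]] := (sigma_finiteP _ _).1 smu.
have [i0 hZ] := square_summable_exhaust sf e3 (fun i => (mZ i).1) ndZ
  ltac:(by rewrite -Z0T setCT measure0).
set Z := Z0 i0 in hZ; have [mZZ Zoo] : measurable Z /\ (mu Z < +oo)%E := mZ i0.
have [dl dl0 hdl] := square_summable_ac sf e3.
have mB : measurable (X0 `&` Z) by exact: measurableI.
have Boo : (mu (X0 `&` Z) < +oo)%E.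
  by rewrite (le_lt_trans _ Zoo) // le_measure ?inE //; exact: subIsetr.
(* Half of [dl], because Lusin's theorem gives a weak inequality and absolute continuity asks for a
   strict one. *)
have [K [cK KB muK phiK]] := lusin_compact hmu mphi sep1 mB Boo (divr_gt0 dl0 (ltr0n _ 2)).
have mK : measurable (K : set (borel X)) by exact: borel_compact.
have Koo : (mu K < +oo)%E by rewrite (le_lt_trans _ Boo) // le_measure ?inE.
have injK : {in K &, injective phi}.
  move=> x y /set_mem Kx /set_mem Ky; apply: inj0; rewrite ?inE.
    by have [] := KB _ Kx.
  by have [] := KB _ Ky.
have [r [mr r0 hr]] := pushed_density mphi phi_ac smu1 mK Koo.
pose S n := [set y : borel X1 | n.+1%:R^-1 <= r y <= n.+1%:R].
have mS n : measurable (S n).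
  have -> : S n = [set: borel X1] `&` r @^-1` `[n.+1%:R^-1, n.+1%:R].
    by rewrite setTI; apply/seteqP; split => y; rewrite /S /preimage /= in_itv.
  by apply: mr.
have mpre E : measurable E -> measurable (phi @^-1` E).
  by move=> mE; rewrite -[X in measurable X]setTI; exact: mphi.
have mpS n : measurable (phi @^-1` (S n)) by exact: mpre.
(* The complement of [K] is added so that the sequence exhausts the whole space up to a null set;
   the chart itself uses only the part inside [K]. *)
pose A n : set (borel X) := ~` K `|` (phi @^-1` (S n)).
have mA n : measurable (A n) by apply: measurableU => //; exact: measurableC.
have ndA : nondecreasing_seq A.
  move=> n m nm; apply/subsetPset; apply: setUS => x; rewrite /preimage /S /= => /andP[h1 h2].
  have nm' : n.+1%:R <= m.+1%:R :> R by rewrite ler_nat.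
  rewrite (le_trans h2 nm') andbT (le_trans _ h1) // lef_pV2 ?posrE ?ltr0n //.
have m0 : measurable (r @^-1` [set 0]).
  by rewrite -[X in measurable X]setTI; exact: mr.
have muA : mu (~` \bigcup_n A n) = 0%E.
  have mC : measurable (~` \bigcup_n A n) by apply: measurableC; exact: bigcup_measurable.
  have mKr : measurable ((K : set (borel X)) `&` phi @^-1` (r @^-1` [set 0])).
    by apply: measurableI => //; exact: mpre.
  (* For q = 1 on the zero set of [r], the change of variables shows that the points of [K] sent
     there form a null set; at all others the density lies in [S n] for large n. *)
  have := hr (cst 1%E) _ m0 (measurable_cst _) (fun=> @lee01 R).
  rewrite integral_cst // mul1e => h0.
  have K0 : mu ((K : set (borel X)) `&` phi @^-1` (r @^-1` [set 0])) = 0%E.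
    by rewrite h0; apply: integral0_eq => y /= ->; rewrite mule0.
  apply/eqP; rewrite eq_le measure_ge0 andbT -K0 le_measure ?inE // => x nx.
  have Kx : K x by apply: contrapT => nK; apply: nx; exists 0%N => //; left.
  split => //; rewrite /preimage /=; apply: contrapT => /eqP rx0.
  have rx : 0 < r (phi x) by rewrite lt_def rx0 r0.
  have [n1 _ h1] := @near_infty_natSinv_lt R (PosNum rx).
  have [n2 h2] : exists n, r (phi x) <= n.+1%:R.
    exists (Num.truncn (r (phi x))); exact: ltW (truncnS_gt _).
  apply: nx; exists (maxn n1 n2) => //; right; rewrite /preimage /S /=.
  apply/andP; split.
    by apply: ltW; apply: h1 => /=; exact: leq_maxl.
  by rewrite (le_trans h2) // ler_nat ltnS leq_maxr.
have [n hn] := square_summable_exhaust sf e3 mA ndA muA.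
have n0 : 0 < n.+1%:R :> R by rewrite ltr0n.
have ch := compact_chart cK phiK injK mr n0 hr.
eexists _, _, _, _, _; split; first exact: ch.
  by move=> x [/KB[]].
move=> N; rewrite -lee_fin; have := chart_dom ch; rewrite -/(S n) => mA0.
set A0 : set (borel X) := K `&` phi @^-1` (S n) in mA0 *.
have L := ((square_summableP mu f).1 sf).1.
have mf : measurable_fun [set: borel X] (pointwise_sqsum f).
  by apply: measurable_pointwise_sqsum => k; exact: L2_cmeasurable (L k).
have f0 x : (0 <= pointwise_sqsum f x)%E by exact: pointwise_sqsum_ge0.
have mXA : measurable (X0 `\` A0) by exact: measurableD.
have mBK : measurable ((X0 `&` Z) `\` K : set (borel X)) by exact: measurableD.
have mZC := measurableC mZZ; have mAC := measurableC (mA n).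
rewrite (le_trans (sum_sqnorm_mulchi N sf mXA)) //.
rewrite (@le_trans _ _ (\int[mu]_(x in ~` Z `|` ((X0 `&` Z) `\` (K : set (borel X)) `|` ~` A n))
    pointwise_sqsum f x)%E) //.
  apply: ge0_subset_integral => //; first by do 2! apply: measurableU => //.
    exact: measurable_funTS.
  move=> x [X0x nA0]; have [Zx|nZ] := pselect (Z x); last by left.
  have [Kx|nK] := pselect (K x); last by right; left.
  by right; right => -[//|Sx]; apply: nA0.
have mU :
    measurable ((X0 `&` Z) `\` (K : set (borel X)) `|` ~` A n : set (borel X)) by exact: measurableU.
rewrite (le_trans (ge0_integral_setU_le mu mZC mU mf f0)) //.
have -> : e = e / 3 + (e / 3 + e / 3) by lra.
rewrite !EFinD; apply: leeD => //.
rewrite (le_trans (ge0_integral_setU_le mu mBK mAC mf f0)) //.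
apply: leeD => //; apply: hdl => //.
by rewrite (le_lt_trans muK) // lte_fin; lra.
Qed.

End chart_existence.

(** * Transfer along charts *)

Section chart_transfer.
Context d d' (X : measurableType d) (X1 : measurableType d') (R : realType).
Variables (mu : {measure set X -> \bar R}) (mu1 : {measure set X1 -> \bar R}).
Variables (phi : X -> X1) (A : set X) (D : set X1) (theta : X1 -> X) (rho : X1 -> R) (c : R).
Hypothesis ch : chart mu mu1 phi A D theta rho c.
Implicit Types (f g u : X -> R[i]) (F : X1 -> R[i]).

Definition chart_push f : X1 -> R[i] := mulchi D (f \o theta).
(** The weight is the Jacobian of the chart: the product of [chart_push u] and [chart_wpush g]
    integrates over X_1 to the integral of u g over A, as [cpairing_push] states. *)
Definition chart_wpush f : X1 -> R[i] := mulchi D (fun y => (rho y)%:C%C * f (theta y)).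
Definition chart_pull F : X -> R[i] := mulchi A (F \o phi).

Let mA := chart_dom ch.
Let mD := chart_cod ch.
Let mphi := chart_fun ch.
Let mtheta := chart_inv ch.
Let mrho := chart_density ch.
Let c0 := chart_gt0 ch.

Let rho_ge0 y : D y -> 0 <= rho y.
Proof.
by move=> /(chart_bound ch)/andP[h _]; apply: le_trans h; rewrite invr_ge0 ltW.
Qed.

Lemma pull_push f : chart_pull (chart_push f) = mulchi A f.
Proof.
apply/funext => x; rewrite /chart_pull /chart_push !mulchiE /= mulchiE.
case: ifPn => // /set_mem /(chart_funK ch)[Dx /= ->].
by rewrite mem_set.
Qed.

Lemma cmeasurable_push f : cmeasurable f -> cmeasurable (chart_push f).
Proof. by move=> mf; apply: cmeasurable_mulchi => //; exact: cmeasurable_comp. Qed.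

Lemma cmeasurable_wpush f : cmeasurable f -> cmeasurable (chart_wpush f).
Proof.
move=> mf; apply: cmeasurable_mulchi => //; apply: cmeasurableM.
  exact: cmeasurable_real.
exact: (cmeasurable_comp mtheta).
Qed.

Lemma cmeasurable_pull F : cmeasurable F -> cmeasurable (chart_pull F).
Proof. by move=> mF; apply: cmeasurable_mulchi => //; exact: cmeasurable_comp. Qed.

Lemma chart_integral_dom (q : X -> \bar R) : measurable_fun [set: X] q ->
  (forall x, 0 <= q x)%E ->
  (\int[mu]_(x in A) q x = \int[mu1]_(y in D) (q (theta y) * (rho y)%:E))%E.
Proof.
move=> mq q0.
have mqt : measurable_fun [set: X1] (q \o theta) by exact: measurableT_comp.
rewrite -(chart_integral ch mqt (fun y => q0 (theta y))).
by apply: eq_integral => x /set_mem /(chart_funK ch)[_ /= ->].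
Qed.

(** On [D] the lower bound of the density gives 1 <= c rho, so inserting the factor c rho only
    increases the integral. The bound for [chart_pull] uses rho <= c instead. *)
Lemma sqint_push f : cmeasurable f ->
  (sqint mu1 (chart_push f) <= c%:E * sqint mu f)%E.
Proof.
move=> mf; have mf2 := measurable_sqint mf.
have f0 x : (0 <= (normc (f x) ^+ 2)%:E)%E by rewrite lee_fin sqr_ge0.
have mft : measurable_fun [set: X1] (fun y => (normc (f (theta y)) ^+ 2)%:E).
  exact: (measurableT_comp mf2 mtheta).
have mr : measurable_fun [set: X1] (fun y => ((normc (f (theta y)) ^+ 2)%:E * (rho y)%:E)%E).
  by apply: emeasurable_funM => //; apply/measurable_EFinP.
rewrite sqint_mulchi //.
rewrite (@le_trans _ _
  (c%:E * \int[mu1]_(y in D) ((normc (f (theta y)) ^+ 2)%:E * (rho y)%:E))%E) //.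
  rewrite -ge0_integralZl_EFin ?(ltW c0) //; last 2 first.
  - by move=> y Dy; rewrite mule_ge0 // lee_fin rho_ge0.
  - exact: measurable_funTS.
  apply: ge0_le_integral => //.
  - by move=> y _; exact: f0.
  - exact: measurable_funTS.
  - by apply: measurable_funTS; exact: measurable_funeM.
  - move=> y Dy; rewrite -!EFinM lee_fin mulrCA ler_peMr ?sqr_ge0 //.
    have /andP[h _] := chart_bound ch Dy.
    by rewrite mulrC -ler_pdivrMr // div1r.
rewrite -(chart_integral_dom mf2 f0) -sqint_mulchi //; apply: lee_wpmul2l.
  by rewrite lee_fin ltW.
exact: sqint_mulchi_le.
Qed.

Lemma sqint_pull F : cmeasurable F ->
  (sqint mu (chart_pull F) <= c%:E * sqint mu1 F)%E.
Proof.
move=> mF; have mF2 := measurable_sqint mF.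
have F0 y : (0 <= (normc (F y) ^+ 2)%:E)%E by rewrite lee_fin sqr_ge0.
rewrite sqint_mulchi // (chart_integral ch mF2 F0).
rewrite (@le_trans _ _ (\int[mu1]_(y in D) (c%:E * (normc (F y) ^+ 2)%:E))%E) //.
  apply: ge0_le_integral => //.
  - by move=> y Dy; rewrite mule_ge0 // lee_fin rho_ge0.
  - by apply: measurable_funTS; apply: emeasurable_funM => //; apply/measurable_EFinP.
  - by apply: measurable_funTS; exact: measurable_funeM.
  - move=> y Dy; rewrite -!EFinM lee_fin mulrC ler_wpM2r ?sqr_ge0 //.
    by have /andP[] := chart_bound ch Dy.
rewrite ge0_integralZl_EFin ?(ltW c0) //; last exact: measurable_funTS.
rewrite -(sqint_mulchi mu1 F mD); apply: lee_wpmul2l; first by rewrite lee_fin ltW.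
exact: sqint_mulchi_le.
Qed.

(** Two factors c bound rho^2; the third comes from [sqint_push]. *)
Lemma sqint_wpush f : cmeasurable f ->
  (sqint mu1 (chart_wpush f) <= (c ^+ 3)%:E * sqint mu f)%E.
Proof.
move=> mf; rewrite (@le_trans _ _ ((c ^+ 2)%:E * sqint mu1 (chart_push f))%E) //; last first.
  rewrite [c ^+ 3]exprSr [(c ^+ 2 * c)%:E]EFinM -[leRHS]muleA.
  apply: lee_wpmul2l; first by rewrite lee_fin sqr_ge0.
  exact: sqint_push.
have mp := measurable_sqint (cmeasurable_push mf).
rewrite /sqint -ge0_integralZl_EFin ?sqr_ge0 //; last by move=> y _; rewrite lee_fin sqr_ge0.
apply: ge0_le_integral => //.
- by move=> y _; rewrite lee_fin sqr_ge0.
- exact: measurable_sqint (cmeasurable_wpush mf).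
- exact: measurable_funeM.
move=> y _; rewrite -EFinM lee_fin /chart_wpush /chart_push !mulchiE.
case: ifPn => [/set_mem Dy|_].
  rewrite ComplexField.Normc.normcM normc_real exprMn ler_wpM2r ?sqr_ge0 //.
  have /andP[_ h] := chart_bound ch Dy.
  by rewrite ger0_norm ?rho_ge0 // ler_pXn2r ?nnegrE ?rho_ge0 ?(ltW c0).
by rewrite ComplexField.Normc.normc0 expr0n mulr0.
Qed.

Lemma L2_push f : L2 mu f -> L2 mu1 (chart_push f).
Proof.
move=> /L2P[mf foo]; apply/L2P; split; first exact: cmeasurable_push.
by apply: (le_lt_trans (sqint_push mf)); rewrite lte_mul_pinfty // lee_fin ltW.
Qed.

Lemma L2_wpush f : L2 mu f -> L2 mu1 (chart_wpush f).
Proof.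
move=> /L2P[mf foo]; apply/L2P; split; first exact: cmeasurable_wpush.
apply: (le_lt_trans (sqint_wpush mf)); rewrite lte_mul_pinfty // lee_fin exprn_ge0 //.
exact: ltW.
Qed.

Lemma L2_pull F : L2 mu1 F -> L2 mu (chart_pull F).
Proof.
move=> /L2P[mF Foo]; apply/L2P; split; first exact: cmeasurable_pull.
by apply: (le_lt_trans (sqint_pull mF)); rewrite lte_mul_pinfty // lee_fin ltW.
Qed.

(** Absolute continuity in the direction from X to X_1, which only the chart provides: [sqint_push]
    for the indicator of [M] bounds the measure on the left by c mu(M). *)
Lemma chart_null (M : set X) : measurable M -> mu M = 0%E ->
  mu1 (D `&` theta @^-1` M) = 0%E.
Proof.
move=> mM M0.
have mtM : measurable (theta @^-1` M) by rewrite -[X in measurable X]setTI; exact: mtheta.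
have mDM : measurable (D `&` theta @^-1` M) by exact: measurableI.
have m1 : cmeasurable (mulchi M (fun=> 1 : R[i])).
  by apply: cmeasurable_mulchi => //; exact: cmeasurable_cst.
have h := sqint_push m1.
have s0 : sqint mu (mulchi M (fun=> 1 : R[i])) = 0%E.
  by rewrite sqint_mulchi // null_set_integral.
rewrite s0 mule0 in h; apply/eqP; rewrite eq_le measure_ge0 andbT (le_trans _ h) //.
rewrite -[X in (X <= _)%E]mul1e -integral_cst // [leLHS]integral_mkcond.
apply: ge0_le_integral => //.
- by move=> y _; rewrite patchE; case: ifP.
- by apply/(measurable_restrictT _ mDM).1; exact: measurable_cst.
- exact: measurable_sqint (cmeasurable_push m1).
move=> y _; rewrite patchE; case: ifPn => [/set_mem[Dy My]|_]; last first.
  by rewrite lee_fin sqr_ge0.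
by rewrite /chart_push mulchiE mem_set // /comp mulchiE mem_set // lee_fin
  normc_sqr /= expr1n expr0n addr0.
Qed.

Lemma ae_eq_push u u' : u = u' %[ae mu] -> chart_push u = chart_push u' %[ae mu1].
Proof.
move=> [M [mM M0 hM]]; exists (D `&` theta @^-1` M); split.
- by apply: measurableI => //; rewrite -[X in measurable X]setTI; exact: mtheta.
- exact: chart_null.
- move=> y /= nuu; apply: contrapT => /not_andP ny; apply: nuu => _.
  rewrite /chart_push !mulchiE; case: ifPn => // /set_mem Dy /=.
  apply: contrapT => nuu; case: ny => [//|nM]; apply: nM; apply: hM => /= /(_ Logic.I).
  exact: nuu.
Qed.

(** The norm bound for [chart_pull], applied to the difference F - F'. *)
Lemma ae_eq_pull F F' : F = F' %[ae mu1] -> L2 mu1 F -> L2 mu1 F' ->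
  chart_pull F = chart_pull F' %[ae mu].
Proof.
move=> FF' hF hF'; have hB := L2B hF hF'.
have s0 : sqint mu1 (fun y => F y - F' y) = 0%E.
  rewrite (@ae_eq_sqint _ _ _ _ _ (fun=> 0)).
  - rewrite /sqint integral0_eq // => y _.
    by rewrite ComplexField.Normc.normc0 expr0n.
  - exact: L2_cmeasurable hB.
  - exact: cmeasurable_cst.
  - by apply: filterS FF' => y /= /[apply] ->; rewrite subrr.
have p0 : sqint mu (chart_pull (fun y => F y - F' y)) = 0%E.
  apply/eqP; rewrite eq_le sqint_ge0 andbT.
  by rewrite (le_trans (sqint_pull (L2_cmeasurable hB))) // s0 mule0.
have := sqint_eq0 (cmeasurable_pull (L2_cmeasurable hB)) p0.
apply: filterS => x /= /[apply]; rewrite /chart_pull !mulchiE /=.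
by case: ifP => // _ /eqP; rewrite subr_eq0 => /eqP.
Qed.

Lemma chart_integral_real (r : X -> R) : measurable_fun [set: X] r ->
  \int[mu]_(x in A) r x = \int[mu1]_(y in D) (r (theta y) * rho y).
Proof.
move=> mr; rewrite /Rintegral; congr fine; rewrite integralE [RHS]integralE.
have mer : measurable_fun [set: X] (EFin \o r) by exact/measurable_EFinP.
congr (_ - _)%E.
  rewrite chart_integral_dom //; last exact: measurable_funepos.
  apply: eq_integral => y /set_mem Dy; rewrite !funeposE /= -!EFin_max -EFinM.
  by rewrite [r _ * _]mulrC [Num.max _ _ * _]mulrC maxr_pMr ?rho_ge0 // mulr0.
rewrite chart_integral_dom //; last exact: measurable_funeneg.
apply: eq_integral => y /set_mem Dy; rewrite !funenegE /= -!EFin_max -EFinM.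
by rewrite [r _ * _]mulrC [Num.max _ _ * _]mulrC maxr_pMr ?rho_ge0 // mulr0 mulrN.
Qed.

Lemma cpairing_push u g : cmeasurable u -> cmeasurable g ->
  cpairing mu1 (chart_push u) (chart_wpush g) = cpairing mu u (mulchi A g).
Proof.
move=> mu_ mg; have [m1 m2] := cmeasurableM mu_ mg.
rewrite /cpairing /cintegral; apply: complexP => /=.
- transitivity (\int[mu]_(x in A) Re (u x * g x)); last first.
    rewrite Rintegral_mkcond; apply: eq_Rintegral => x _; rewrite patchE mulchiE.
    by case: ifP => // _; rewrite mulr0.
  rewrite chart_integral_real // [RHS]Rintegral_mkcond; apply: eq_Rintegral => y _.
  rewrite /chart_push /chart_wpush patchE !mulchiE; case: ifP => // _; last by rewrite mulr0.
  by rewrite /= mulrCA Re_mulc /= mul0r subr0 mulrC.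
- transitivity (\int[mu]_(x in A) Im (u x * g x)); last first.
    rewrite Rintegral_mkcond; apply: eq_Rintegral => x _; rewrite patchE mulchiE.
    by case: ifP => // _; rewrite mulr0.
  rewrite chart_integral_real // [RHS]Rintegral_mkcond; apply: eq_Rintegral => y _.
  rewrite /chart_push /chart_wpush patchE !mulchiE; case: ifP => // _; last by rewrite mulr0.
  by rewrite /= mulrCA Im_mulc /= mul0r addr0 mulrC.
Qed.

End chart_transfer.

Lemma normr_series_cvg (R : realType) (u : nat -> R) (B : R) :
  (forall n, \sum_(0 <= k < n) `|u k| <= B) ->
  exists l, (\sum_(0 <= k < n) u k) @[n --> \oo] --> (l : R).
Proof.
move=> hB.
have h1 : cvgn (series (fun k => `|u k|)).
  apply: nondecreasing_is_cvgn.
    apply/nondecreasing_seqP => n; rewrite /series /=.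
    by rewrite [leRHS]big_nat_recr //= lerDl.
  by exists B => _ [n _ <-]; exact: hB.
by exists (limn (series u)); exact: (normed_cvg h1).
Qed.

(** * The operator between the L^2 spaces of X_1 and Y_1 *)

Section transferred_operator.
Context dX (X : measurableType dX) dY (Y : measurableType dY) (R : realType).
Context dX1 (X1 : measurableType dX1) dY1 (Y1 : measurableType dY1).
Variables (mu : {measure set X -> \bar R}) (nu : {measure set Y -> \bar R}).

(** Membership in [Mmin] says that a limit of the pairing is 0 if there is one, so convergence has
    to be known before it is used. The bound with t = 1 gives absolute convergence. *)
Lemma pairing_cvg b f g : bounded_bilinear mu nu b ->
  square_summable mu f -> square_summable nu g ->
  exists z : R[i], null_seq (fun n => \sum_(0 <= k < n) b (f k) (g k) - z).
Proof.
move=> [_ _ [C C0 hC]] sf sg; have [Lf _] := sf; have [Lg _] := sg.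
have [A A0 hA] := square_summable_bound sf.
have [B B0 hB] := square_summable_bound sg.
have bound n : \sum_(0 <= k < n) normc (b (f k) (g k)) <= C * A + B.
  rewrite (@le_trans _ _ (\sum_(0 <= k < n) (C * sqnorm mu (f k) + sqnorm nu (g k)))) //.
    apply: ler_sum => k _; have := hC 1 _ _ ltr01 (Lf k) (Lg k).
    by rewrite invr1 !mul1r.
  rewrite big_split /= -mulr_sumr; apply: lerD => //.
  exact: ler_wpM2l.
have [x hx] := @normr_series_cvg R (fun k => Re (b (f k) (g k))) (C * A + B)
  (fun n => le_trans (ler_sum _ (fun k _ => normr_Re_le _)) (bound n)).
have [y hy] := @normr_series_cvg R (fun k => Im (b (f k) (g k))) (C * A + B)
  (fun n => le_trans (ler_sum _ (fun k _ => normr_Im_le _)) (bound n)).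
exists (x +i* y)%C; apply/null_seqP => e e0.
have e2 : 0 < e / 2 by rewrite divr_gt0.
have [N1 _ h1] := (cvgrPdist_lt _ _).1 hx _ e2.
have [N2 _ h2] := (cvgrPdist_lt _ _).1 hy _ e2.
exists (maxn N1 N2) => n; rewrite geq_max => /andP[n1 n2].
have k1 := h1 n n1; have k2 := h2 n n2; rewrite /= in k1 k2.
rewrite (le_lt_trans (normc_le_ReIm _)) // [e]splitr ltrD //.
- have -> : Re (\sum_(0 <= k < n) b (f k) (g k) - (x +i* y)%C) =
    - (x - \sum_(0 <= k < n) Re (b (f k) (g k))).
    rewrite Re_addc (big_morph (@complex.Re R) (@Re_addc R) (erefl : Re 0 = 0)) /=.
    by rewrite opprB.
  by rewrite normrN.
- have -> : Im (\sum_(0 <= k < n) b (f k) (g k) - (x +i* y)%C) =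
    - (y - \sum_(0 <= k < n) Im (b (f k) (g k))).
    rewrite Im_addc (big_morph (@complex.Im R) (@Im_addc R) (erefl : Im 0 = 0)) /=.
    by rewrite opprB.
  by rewrite normrN.
Qed.

Variables (mu1 : {measure set X1 -> \bar R}) (nu1 : {measure set Y1 -> \bar R}).
Variables (phi : X -> X1) (A : set X) (D : set X1) (theta : X1 -> X) (rho : X1 -> R) (c : R).
Variables (psi : Y -> Y1) (B : set Y) (E : set Y1) (eta : Y1 -> Y) (sigma : Y1 -> R) (s : R).
Hypothesis chX : chart mu mu1 phi A D theta rho c.
Hypothesis chY : chart nu nu1 psi B E eta sigma s.
Variable T : (X -> R[i]) -> (Y -> R[i]).

(** The compression P(B) T P(A), read through the two charts. *)
Definition transfer (F : X1 -> R[i]) : Y1 -> R[i] :=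
  chart_push E eta (T (chart_pull phi A F)).

Let c0 : 0 < c := chart_gt0 chX.
Let s0 : 0 < s := chart_gt0 chY.

Lemma chart_push_lin (a : R[i]) (u v : Y -> R[i]) :
  chart_push E eta (fun y => a * u y + v y) =
  fun y => a * chart_push E eta u y + chart_push E eta v y.
Proof.
apply/funext => y; rewrite /chart_push !mulchiE; case: ifP => //=.
by rewrite mulr0 addr0.
Qed.

Lemma chart_pull_lin (a : R[i]) (u v : X1 -> R[i]) :
  chart_pull phi A (fun y => a * u y + v y) =
  fun x => a * chart_pull phi A u x + chart_pull phi A v x.
Proof.
apply/funext => y; rewrite /chart_pull !mulchiE; case: ifP => //=.
by rewrite mulr0 addr0.
Qed.

Lemma L2norm_pull F : L2 mu1 F ->
  (L2norm mu (chart_pull phi A F) <= (Num.sqrt c)%:E * L2norm mu1 F)%E.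
Proof.
move=> hF; apply: L2norm_le; first exact: sqrtr_ge0.
rewrite sqr_sqrtr ?(ltW c0) //; apply: (sqint_pull chX); exact: L2_cmeasurable hF.
Qed.

Lemma L2norm_push u : L2 nu u ->
  (L2norm nu1 (chart_push E eta u) <= (Num.sqrt s)%:E * L2norm nu u)%E.
Proof.
move=> hu; apply: L2norm_le; first exact: sqrtr_ge0.
rewrite sqr_sqrtr ?(ltW s0) //; apply: (sqint_push chY); exact: L2_cmeasurable hu.
Qed.

Lemma bounded_transfer : bounded_operator mu nu T -> bounded_operator mu1 nu1 transfer.
Proof.
move=> [TL2 Tae Tlin [C TC]]; split.
- by move=> F hF; apply: (L2_push chY); apply: TL2; exact: (L2_pull chX).
- move=> F G hF hG FG; apply: (ae_eq_push chY); apply: Tae.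
  + exact: (L2_pull chX).
  + exact: (L2_pull chX).
  + exact: (ae_eq_pull chX).
- move=> a F G hF hG; rewrite /transfer chart_pull_lin.
  have := ae_eq_push chY (Tlin a _ _ (L2_pull chX hF) (L2_pull chX hG)).
  by rewrite chart_push_lin.
(* The roots appear because the chart estimates bound squared norms; the constant of [T] is an
   arbitrary real, hence the absolute value. *)
- exists (Num.sqrt s * (`|C| * Num.sqrt c)) => F hF.
  have hp := L2_pull chX hF; have n0 : (0 <= L2norm mu1 F)%E by exact: Lnorm_ge0.
  apply: (le_trans (L2norm_push (TL2 _ hp))).
  rewrite EFinM -muleA; apply: lee_wpmul2l; first by rewrite lee_fin sqrtr_ge0.
  apply: (le_trans (TC _ hp)).
  have p0 : (0 <= L2norm mu (chart_pull phi A F))%E by exact: Lnorm_ge0.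
  rewrite (@le_trans _ _ (`|C|%:E * L2norm mu (chart_pull phi A F))%E) //.
    by apply: lee_wpmul2r => //; rewrite lee_fin ler_norm.
  rewrite EFinM -muleA; apply: lee_wpmul2l; first by rewrite lee_fin.
  exact: L2norm_pull.
Qed.

Lemma compact_transfer : compact_operator mu nu T -> compact_operator mu1 nu1 transfer.
Proof.
move=> [bT cT]; split; first exact: bounded_transfer.
have [TL2 _ _ _] := bT.
move=> F LF [C hC].
have [k [g [hk Lg hg]]] : exists k g, [/\ {homo k : m n / (m < n)%N}, L2 nu g &
    L2norm nu (fun y => T (chart_pull phi A (F (k n))) y - g y)%R @[n --> \oo] --> 0%E].
  apply: (cT (fun n => chart_pull phi A (F n))).
    by move=> n; exact: (L2_pull chX).
  exists (Num.sqrt c * C) => n; apply: (le_trans (L2norm_pull (LF n))).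
  by rewrite EFinM; apply: lee_wpmul2l; rewrite ?lee_fin ?sqrtr_ge0.
exists k, (chart_push E eta g); split => //; first exact: (L2_push chY).
have hB n : L2 nu (fun y => T (chart_pull phi A (F (k n))) y - g y).
  by apply: L2B => //; apply: TL2; exact: (L2_pull chX).
apply: (@squeeze_cvge _ _ _ _ (cst 0%E) _ (fun n => ((Num.sqrt s)%:E *
    L2norm nu (fun y => T (chart_pull phi A (F (k n))) y - g y)%R)%E)).
- apply: nearW => n; apply/andP; split; first exact: Lnorm_ge0.
  rewrite (_ : (fun y => transfer (F (k n)) y - chart_push E eta g y) =
    chart_push E eta (fun y => T (chart_pull phi A (F (k n))) y - g y)).
    exact: L2norm_push.
  apply/funext => y; rewrite /transfer /chart_push !mulchiE.
  by case: ifP => //=; rewrite subr0.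
- exact: cvg_cst.
- by rewrite -(mule0 (Num.sqrt s)%:E); apply: cvgeZl.
Qed.

Lemma transfer_pairing f g : bounded_operator mu nu T -> L2 mu f -> L2 nu g ->
  cpairing nu1 (transfer (chart_push D theta f)) (chart_wpush E eta sigma g) =
  cpairing nu (T (mulchi A f)) (mulchi B g).
Proof.
move=> [TL2 _ _ _] hf hg.
rewrite /transfer (cpairing_push chY) ?(pull_push chX) //.
- by apply: L2_cmeasurable; apply: TL2; apply: L2_mulchi => //; exact: chart_dom chX.
- exact: L2_cmeasurable hg.
Qed.

Hypotheses (mphi : measurable_fun [set: X] phi) (mpsi : measurable_fun [set: Y] psi).
Hypotheses (phi_ac : pushforward mu phi `<< mu1) (psi_ac : pushforward nu psi `<< nu1).
Variable kappa1 : set (X1 * Y1).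
Let kappa := [set p : X * Y | kappa1 (phi p.1, psi p.2)].

(** The preimage of a rectangle marginally disjoint from [kappa1] is a rectangle marginally disjoint
    from [kappa], and cutting by a set in X_1 or Y_1 corresponds, through pull and push, to cutting
    by its preimage. *)
Lemma transfer_Mmax : Mmax mu nu kappa T -> Mmax mu1 nu1 kappa1 transfer.
Proof.
move=> [bT hT]; split; first exact: bounded_transfer.
have [TL2 _ _ _] := bT.
move=> al be mal mbe hnull F hF.
have hn : marginally_null mu nu ((phi @^-1` al `*` psi @^-1` be) `&` kappa).
  apply: sub_marginally_null (marginally_null_preimage mphi mpsi phi_ac psi_ac hnull).
  by move=> [x y] /= [[h1 h2] h3].
have mal' : measurable (phi @^-1` al) by rewrite -[X in measurable X]setTI; exact: mphi.
have mbe' : measurable (psi @^-1` be) by rewrite -[X in measurable X]setTI; exact: mpsi.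
have h0 := hT _ _ mal' mbe' hn _ (L2_pull chX hF).
have e1 : chart_pull phi A (mulchi al F) = mulchi (phi @^-1` al) (chart_pull phi A F).
  apply/funext => x; rewrite /chart_pull !mulchiE /comp mulchiE.
  by have -> : (phi x \in al) = (x \in phi @^-1` al) by []; case: (x \in A); case: (x \in _).
have e2 u : mulchi be (chart_push E eta u) = chart_push E eta (mulchi (psi @^-1` be) u).
  apply/funext => y; rewrite /chart_push !mulchiE /= mulchiE.
  have [Ey|nE] := pselect (E y); last by rewrite (memNset nE); case: ifP.
  have [_ ey] := chart_invK chY Ey.
  rewrite (mem_set Ey); have -> // : (eta y \in psi @^-1` be) = (y \in be).
  by apply/idP/idP; rewrite !inE /preimage /= ey.
rewrite /transfer e1 e2.
have push0 : chart_push E eta (fun=> 0 : R[i]) = fun=> 0.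
  by apply/funext => y; rewrite /chart_push mulchiE; case: ifP.
by have := ae_eq_push chY h0; rewrite push0.
Qed.

Lemma square_summable_le d (Z : measurableType d) d' (Z1 : measurableType d')
    (la : {measure set Z -> \bar R}) (la1 : {measure set Z1 -> \bar R})
    (K : R) (f : nat -> Z -> R[i]) (F : nat -> Z1 -> R[i]) : 0 <= K ->
  (forall k, L2 la1 (F k)) -> (forall k, sqint la1 (F k) <= K%:E * sqint la (f k))%E ->
  square_summable la f -> square_summable la1 F.
Proof.
move=> K0 LF FK [_ foo]; split => //.
rewrite (@le_lt_trans _ _ (K%:E * \sum_(0 <= n <oo) L2norm la (f n) ^+ 2)%E) //.
  rewrite -nneseriesZl //; last by move=> n _; rewrite L2norm_sqr sqint_ge0.
  by apply: lee_nneseries => n _; rewrite !L2norm_sqr ?sqint_ge0.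
by rewrite lte_mul_pinfty.
Qed.

Lemma transfer_marginally_ae (P : X * Y -> Prop) : marginally_ae mu nu P ->
  marginally_ae mu1 nu1 (fun p => D p.1 -> E p.2 -> P (theta p.1, eta p.2)).
Proof.
move=> [M [N [[mM M0] [mN N0] hMN]]].
exists (D `&` theta @^-1` M), (E `&` eta @^-1` N); split.
- split; last exact: (chart_null chX).
  apply: measurableI; first exact: chart_cod chX.
  by rewrite -[X in measurable X]setTI; apply: (chart_inv chX).
- split; last exact: (chart_null chY).
  apply: measurableI; first exact: chart_cod chY.
  by rewrite -[X in measurable X]setTI; apply: (chart_inv chY).
- move=> [x y] /= h; have [Dx|nD] := pselect (D x); last by case: h => /nD.
  have [Ey|nE] := pselect (E y); last by case: h => _ /nE.
  have nP : ~ P (theta x, eta y) by move=> hP; apply: h.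
  by case: (hMN (theta x, eta y) nP) => [[? _]|[_ ?]]; [left|right].
Qed.

(** The tensor h, restricted to A x B, is carried to [h1] on D x E. As (theta x, eta y) is in
    [kappa] exactly when (x, y) is in [kappa1], [h1] belongs to Phi(kappa1), and its pairing with
    [transfer] is the contribution of A x B. *)
Lemma null_block_chart h f g : Mmin mu1 nu1 kappa1 transfer ->
  bounded_operator mu nu T ->
  tensor_expansion mu nu h f g ->
  marginally_ae mu nu (fun p => h p * (\1_kappa p)%:C%C = 0) ->
  null_block nu T f g A B.
Proof.
move=> [_ hmin] bT hfg hk; have [sf sg hcv] := hfg.
have [Lf _] := sf; have [Lg _] := sg.
have mA := chart_dom chX; have mB := chart_dom chY.
have [z hz] := pairing_cvg (bounded_operator_bilinear bT)
  (square_summable_mulchi mA sf) (square_summable_mulchi mB sg).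
pose F k := chart_push D theta (f k).
pose G k := chart_wpush E eta sigma (g k).
(* The factor [sigma] matches the weight in [chart_wpush], carried by the second factor only. *)
pose h1 (p : X1 * Y1) : R[i] := mulchi D (fun=> 1) p.1 * mulchi E (fun=> 1) p.2 *
   ((sigma p.2)%:C%C * h (theta p.1, eta p.2)).
have exp1 : tensor_expansion mu1 nu1 h1 F G.
  split.
  - apply: square_summable_le (ltW c0) _ _ sf => k; first exact: (L2_push chX).
    by apply: (sqint_push chX); exact: L2_cmeasurable.
  - apply: square_summable_le (exprn_ge0 3 (ltW s0)) _ _ sg => k.
      exact: (L2_wpush chY).
    by apply: (sqint_wpush chY); exact: L2_cmeasurable.
  - apply: marginally_ae_sub (transfer_marginally_ae hcv) _ => -[x y] /= hxy.
    apply/cvg_null_seq; rewrite /h1 /F /G /chart_push /chart_wpush /= !mulchiE.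
    have [Dx|nD] := pselect (D x); last first.
      rewrite (_ : (fun _ => _) = fun=> 0); first exact: null_seq0.
      apply/funext => n; rewrite big1 => [|k _]; last by rewrite mulchiE (memNset nD) mul0r.
      by rewrite (memNset nD) !mul0r subr0.
    have [Ey|nE] := pselect (E y); last first.
      rewrite (_ : (fun _ => _) = fun=> 0); first exact: null_seq0.
      apply/funext => n; rewrite big1 => [|k _].
        by rewrite (memNset nE) mulr0 mul0r subr0.
      by rewrite [mulchi E _ _]mulchiE (memNset nE) mulr0.
    have := null_seqZ (sigma y)%:C%C ((cvg_null_seq _ _).1 (hxy Dx Ey)).
    congr (null_seq _); apply/funext => n.
    rewrite (mem_set Dx) (mem_set Ey) !mul1r mulrBr mulr_sumr; congr (_ - _).
    by apply: eq_bigr => k _; rewrite !mulchiE (mem_set Dx) (mem_set Ey) /= mulrCA.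
have phi1 : Phi mu1 nu1 kappa1 h1.
  split; first by exists F, G.
  apply: marginally_ae_sub (transfer_marginally_ae hk) _ => -[x y] /= hxy.
  rewrite /h1 /= !mulchiE.
  have [Dx|nD] := pselect (D x); last by rewrite (memNset nD) !mul0r.
  have [Ey|nE] := pselect (E y); last by rewrite (memNset nE) mulr0 !mul0r.
  have := hxy Dx Ey; rewrite !indicE.
  have [_ ex] := chart_invK chX Dx; have [_ ey] := chart_invK chY Ey.
  have -> : ((theta x, eta y) \in kappa) = ((x, y) \in kappa1).
    by apply/idP/idP; rewrite !inE /kappa /= ex ey.
  by move=> hh; rewrite (mem_set Dx) (mem_set Ey) !mul1r -mulrA hh mulr0.
have z0 : z = 0.
  apply: (hmin h1 phi1); exists F, G; split => //; apply/cvg_null_seq.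
  move: hz; congr (null_seq _); apply/funext => n; congr (_ - _).
  by apply: eq_bigr => k _; rewrite L2inner_conj transfer_pairing.
by move: hz; rewrite z0; congr (null_seq _); apply/funext => n; rewrite subr0.
Qed.

End transferred_operator.

(** * Assembly of the blocks X_i x Y_j *)

Lemma mulchiB d (X : measurableType d) (R : realType) (A B : set X) (f : X -> R[i]) :
  B `<=` A -> (fun x => mulchi A f x - mulchi B f x) = mulchi (A `\` B) f.
Proof.
move=> BA; apply/funext => x; rewrite !mulchiE.
have [Bx|nB] := pselect (B x).
  by rewrite (mem_set Bx) (mem_set (BA _ Bx)) subrr memNset // => -[].
rewrite (memNset nB) subr0; have [Ax|nA] := pselect (A x).
  by rewrite !mem_set.
by rewrite !memNset // => -[].
Qed.

Theorem theorem4p7 (R : realType) (X X1 Y Y1 : pointedCompleteMetricType R)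
  (mu : {measure set (borel X) -> \bar R})
  (mu1 : {measure set (borel X1) -> \bar R})
  (nu : {measure set (borel Y) -> \bar R})
  (nu1 : {measure set (borel Y1) -> \bar R})
  (hmu : standard_measure mu) (hmu1 : standard_measure mu1)
  (hnu : standard_measure nu) (hnu1 : standard_measure nu1)
  (phi : borel X -> borel X1) (psi : borel Y -> borel Y1)
  (mphi : measurable_fun [set: borel X] phi)
  (mpsi : measurable_fun [set: borel Y] psi)
  (phi_ac : pushforward mu phi `<< mu1)
  (psi_ac : pushforward nu psi `<< nu1)
  (kappa1 : set (borel X1 * borel Y1))
  (kappa1_closed : omega_closed mu1 nu1 kappa1)
  (N M : nat) (Xt : 'I_N.+1 -> set (borel X)) (Yt : 'I_M.+1 -> set (borel Y))
  (mXt : forall i, measurable (Xt i)) (mYt : forall j, measurable (Yt j))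
  (Xt_disj : trivIset [set: 'I_N.+1] Xt) (Yt_disj : trivIset [set: 'I_M.+1] Yt)
  (Xt_cover : \bigcup_i Xt i = [set: borel X])
  (Yt_cover : \bigcup_j Yt j = [set: borel Y])
  (phi_inj : set_inj (Xt ord0) phi) (psi_inj : set_inj (Yt ord0) psi)
  (phi_const : forall i, i != ord0 -> ae_constant_on mu (Xt i) phi)
  (psi_const : forall j, j != ord0 -> ae_constant_on nu (Yt j) psi) :
  compact_operator_synthesis mu1 nu1 kappa1 ->
  compact_operator_synthesis mu nu
    [set p : borel X * borel Y | kappa1 (phi p.1, psi p.2)].
Proof.
move=> [_ synth1]; split; first exact: (omega_closed_preimage mphi mpsi phi_ac psi_ac).
have [_ _ _ smu] := hmu; have [_ _ _ snu] := hnu.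
apply/seteqP; split => T [hT cT]; split => //; first exact: sub_Mmin_Mmax.
have [bT _] := hT; split => // h [_ hk] z [f [g [hfg hz]]].
have [sf sg _] := hfg; have [Lf _] := sf; have [Lg _] := sg.
have hz' : null_seq (fun n => \sum_(0 <= k < n) cpairing nu (T (f k)) (g k) - z).
  move/cvg_null_seq : hz; congr (null_seq _); apply/funext => n; congr (_ - _).
  by apply: eq_bigr => k _; rewrite L2inner_conj.
(* The partial sums are known to tend to z; it suffices that they also tend to 0. *)
apply: null_seq_unique hz'.
apply: (null_block_bigsetU hT hfg mXt mYt) => // i j.
have [i0|i1] := eqVneq i ord0; last first.
  apply: (null_block_constl mphi mpsi phi_ac psi_ac smu snu kappa1_closed hT hfg hk) => //.
  exact: phi_const.
have [j0|j1] := eqVneq j ord0; last first.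
  apply: (null_block_constr mphi mpsi phi_ac psi_ac smu snu kappa1_closed hT hfg hk) => //.
  exact: psi_const.
(* Charts fill X_0 and Y_0 only up to an error, and each pair of charts has its own transferred
   operator. The approximation is therefore made on the sequences f and g, for the fixed form given
   by [T]. *)
rewrite {}i0 {}j0; apply: (null_pairing_approx (bounded_operator_bilinear bT)).
- exact: square_summable_mulchi.
- exact: square_summable_mulchi.
move=> e e0.
have [A [D [theta [rho [c [chX AX hA]]]]]] :=
  chart_exhaustion mphi hmu hmu1 phi_ac (mXt ord0) phi_inj sf e0.
have [B [E [eta [sigma [s [chY BY hB]]]]]] :=
  chart_exhaustion mpsi hnu hnu1 psi_ac (mYt ord0) psi_inj sg e0.
exists (fun k => mulchi A (f k)), (fun k => mulchi B (g k)); split.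
- by move=> k; apply: L2_mulchi => //; exact: chart_dom chX.
- by move=> k; apply: L2_mulchi => //; exact: chart_dom chY.
- by move=> n; rewrite (le_trans _ (hA n)) // ler_sum // => k _; rewrite mulchiB.
- by move=> n; rewrite (le_trans _ (hB n)) // ler_sum // => k _; rewrite mulchiB.
(* Compactness of [T] enters here: synthesis of [kappa1] moves the transferred operator from [Mmax]
   to [Mmin]. *)
have h1 : (Mmax mu1 nu1 kappa1 `&` compact_operator mu1 nu1) (transfer phi A E eta T).
  split; last exact: (compact_transfer chX chY cT).
  exact: (transfer_Mmax chX chY mphi mpsi phi_ac psi_ac hT).
rewrite -synth1 in h1; case: h1 => hmin _.
exact: (null_block_chart chX chY hmin bT hfg hk).
Qed.
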